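(* Let $\alpha$ be a partition with all parts $\ge 2$ and overlapping partition $p=(p_1,\dots,p_{\ell(\alpha)-1},0)$. For $1\le i\le \ell(p)-1$ let $\varrho_i=1+\sum_{q=i+1}^{\ell(\alpha)}\alpha_q-p_{i+1}$ and let $\tilde g^i=(\tilde g^i_1,\dots,\tilde g^i_i)$ with $\tilde g^i_j=[\varrho_i-\alpha_j]_+$. Then the Schur support $[R_\alpha^p]$ is a proper subset of $[\alpha,(|\alpha|-p_1,p_1)]$ if and only if $\ell(p)\ge 2$ and, for some $1\le i\le \ell(p)-1$, $$\sum_{j=1}^i[\varrho_i-\alpha_j]_+\le p_{i+1}-1.$$ In this case, $\alpha_j+\tilde g^i_j\ge \varrho_i\ge p_{i+1}-1-|\tilde g^i|$ for $j=1,\dots,i$ (where $|\tilde g^i|=\sum_j\tilde g^i_j$), and the decreasing rearrangement of $(\alpha_1+\tilde g^i_1,\dots,\alpha_i+\tilde g^i_i,\varrho_i,p_{i+1}-1-|\tilde g^i|)$ is a partition of $|\alpha|$ lying in $[\alpha,(|\alpha|-p_1,p_1)]$ but not in $[R_\alpha^p]$.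
   Context: A partition $\alpha=(\alpha_1\ge\dots\ge\alpha_{\ell(\alpha)}>0)$ has length $\ell(\alpha)$ and size $|\alpha|$. A ribbon is a skew Young diagram (English convention) containing no $2\times2$ square. For a partition $\alpha$ with all parts $\ge2$, a ribbon $R_\alpha$ has rows, from top to bottom, of lengths $\alpha_1,\dots,\alpha_{\ell(\alpha)}$, consecutive rows sharing at most one column and non-consecutive rows sharing none. Its overlapping partition is $p=(p_1,\dots,p_{\ell(\alpha)-1},0)$ where $p_i$ is the number of columns of length two in the last $\ell(\alpha)-i+1$ rows; $\ell(p)$ is the number of nonzero parts of $p$. The ribbon is determined by $(\alpha,p)$ and denoted $R_\alpha^p$. For a skew shape $A$, $s_A=\sum_\nu c_A^\nu s_\nu$ and the Schur support is $[A]=\{\nu: c_A^\nu>0\}$. $\preceq$ is dominance order and $[\lambda,\mu]=\{\nu:\lambda\preceq\nu\preceq\mu\}$; one has $[R_\alpha^p]\subseteq[\alpha,(|\alpha|-p_1,p_1)]$. For a real $x$, $[x]_+=\max\{0,x\}$. *)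

(* Defs.v *)
From mathcomp Require Import all_boot all_order all_algebra.
From mathcomp.multinomials Require Import mpoly.

Set Implicit Arguments.
Unset Strict Implicit.
Unset Printing Implicit Defensive.

Local Open Scope nat_scope.

(* A partition is the decreasing sequence of its nonzero parts, so distinct
   sequences are distinct partitions; parts beyond the length read as 0. *)
Definition is_part (s : seq nat) : bool := sorted geq s && (0 \notin s).

(* The i-th part, numbered from 1. *)
Definition part (s : seq nat) (i : nat) : nat := nth 0 s i.-1.

Definition nb_nonzero (s : seq nat) : nat := count (fun x => x != 0) s.

Definition dominated (la mu : seq nat) : Prop :=
  sumn la = sumn mu /\ forall k, sumn (take k la) <= sumn (take k mu).

Definition dom_interval (la mu nu : seq nat) : Prop :=
  [/\ is_part nu, dominated la nu & dominated nu mu].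

Definition decr_rearrangement (s : seq nat) : seq nat :=
  [seq x <- sort geq s | x != 0].

(* Skew diagrams la/mu in the English convention: rows (downwards) and columns
   (rightwards) are numbered from 0. *)
Definition skew_shape (la mu : seq nat) : Prop :=
  [/\ is_part la, is_part mu & forall r, nth 0 mu r <= nth 0 la r].

Definition in_skew (la mu : seq nat) (r c : nat) : bool :=
  (nth 0 mu r <= c) && (c < nth 0 la r).

Definition is_ribbon (la mu : seq nat) : Prop :=
  skew_shape la mu /\
  forall r c, ~~ [&& in_skew la mu r c, in_skew la mu r c.+1,
                     in_skew la mu r.+1 c & in_skew la mu r.+1 c.+1].

(* The last clause excludes empty columns; without it a disconnected ribbon
   would not be determined by its row lengths and overlaps. *)
Definition ribbon_with_rows (alpha la mu : seq nat) : Prop :=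
  [/\ is_ribbon la mu,
      size la = size alpha,
      forall r, nth 0 la r - nth 0 mu r = nth 0 alpha r &
      forall c, c < head 0 la -> exists r, in_skew la mu r c].

(* The length of column c in the subdiagram formed by the rows r, r + 1, ... *)
Definition col_length_from (la mu : seq nat) (r c : nat) : nat :=
  count (fun r' => in_skew la mu r' c) (iota r (size la - r)).

Definition overlapping_partition (la mu : seq nat) : seq nat :=
  mkseq (fun r => count (fun c => col_length_from la mu r c == 2)
                        (iota 0 (head 0 la)))
        (size la).

Definition cell (la mu : seq nat) : finType :=
  {b : 'I_(size la) * 'I_(head 0 la) | in_skew la mu b.1 b.2}.

Definition is_ssyt (la mu : seq nat) (n : nat)
    (T : {ffun cell la mu -> 'I_n}) : bool :=
  [forall a : cell la mu, forall b : cell la mu,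
    (((val a).1 == (val b).1) && ((val a).2 < (val b).2) ==> (T a <= T b)) &&
    (((val a).2 == (val b).2) && ((val a).1 < (val b).1) ==> (T a < T b))].

(* The skew Schur function s_{la/mu} restricted to n variables. *)
Definition skew_schur (n : nat) (la mu : seq nat) : {mpoly int[n]} :=
  (\sum_(T : {ffun cell la mu -> 'I_n} | is_ssyt T)
     \prod_(b : cell la mu) 'X_(T b))%R.

Definition schur (n : nat) (la : seq nat) : {mpoly int[n]} :=
  skew_schur n la [::].

(* s_{la/mu} = sum over nu in s of c(nu) s_nu as symmetric functions, i.e. in
   every number of variables. *)
Definition schur_expansion (la mu : seq nat)
    (s : seq (seq nat)) (c : seq nat -> int) : Prop :=
  [/\ uniq s, all is_part s &
      forall n, skew_schur n la mu = (\sum_(nu <- s) c nu *: schur n nu)%R].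

(* The Schur functions form a Z-basis of the ring of symmetric functions, so
   the expansion exists and its nonzero coefficients are unique. *)
Definition schur_support (la mu nu : seq nat) : Prop :=
  exists (s : seq (seq nat)) (c : seq nat -> int),
    [/\ schur_expansion la mu s c, nu \in s & (0 < c nu)%R].

Definition proper_subset (A B : seq nat -> Prop) : Prop :=
  (forall nu, A nu -> B nu) /\ (exists nu, B nu /\ ~ A nu).

(* Subtraction on nat is truncated: in rho it never truncates, since p_(i+1)
   is at most the sum of the alpha_q with q > i, while in gtilde the truncation
   is the positive part. *)
Definition rho (alpha p : seq nat) (i : nat) : nat :=
  (1 + \sum_(i.+1 <= q < (size alpha).+1) part alpha q) - part p i.+1.

Definition gtilde (alpha p : seq nat) (i j : nat) : nat :=
  rho alpha p i - part alpha j.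

Definition gtilde_size (alpha p : seq nat) (i : nat) : nat :=
  \sum_(1 <= j < i.+1) gtilde alpha p i j.

Definition witness_seq (alpha p : seq nat) (i : nat) : seq nat :=
  [seq part alpha j + gtilde alpha p i j | j <- iota 1 i] ++
  [:: rho alpha p i; part p i.+1 - 1 - gtilde_size alpha p i].

(* Main.v *)
Require Import Defs.
From mathcomp Require Import all_boot all_order all_algebra all_fingroup.
From mathcomp.multinomials Require Import mpoly.
From mathcomp Require Import zify.

(** Number rows and parts from 0 and let [B i] be the number of columns of the rows
    [i, i + 1, ...] of the ribbon.  The Schur support consists of the partitions
    [nu] of the size of [alpha] that dominate [alpha] and satisfy [nu_i <= B i]
    for all [i].  Such a [nu] in the dominance interval fails [nu_i <= B i] for
    some [i >= 1] iff [nu_0, ..., nu_i] are all at least [rho_i = B i + 1], and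
    the smallest way to achieve this while dominating [alpha] is the witness;
    it fits into the size of [alpha] iff the inequality of the theorem holds.

    The Littlewood-Richardson rule is proved for all skew shapes by Stembridge's
    sign-reversing involution, with tableaux encoded as Gelfand-Tsetlin patterns
    on which the Bender-Knuth involution is a piecewise linear toggle.  Reading
    the ribbon from the bottom row upwards, Littlewood-Richardson tableaux are
    chains of horizontal strips of sizes [alpha_l, ..., alpha_1], and the first
    part of the shape reached after the rows [>= i] is at most [B i] because
    every overlap costs a box outside of the first row.  Conversely, the chain
    is built by peeling off strips greedily from the bottom of [nu]. *)

Set Implicit Arguments.
Unset Strict Implicit.
Unset Printing Implicit Defensive.
Import GRing.Theory Num.Theory.
Local Open Scope nat_scope.

(** * Preliminaries on sequences and sums *)

(** The delicate direction is the existence of the chain. Where two ribbon rows overlap, the descent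
    condition links two successive peeling steps. They are decoupled by a promise: every strip meets
    the last row [r] among those of maximal length [nu 0]. The strip of the ribbon row above then
    only has to meet some row [i] whose remaining length satisfies [w i < w 0], which concerns a
    single step. The promise takes one box from row [r] of the upper bound of the greedy choice, and
    it has to be shown that enough room is left. This is where parts of size at least 2 matter: the
    rows from [i] on have at least [2 * (l - i)] boxes and at most [l - i - 1] overlaps, so [B i] is
    at least [l - i + 1], and [B] decreases strictly. On the side of symmetric functions, a support
    is defined by an expansion valid in every number of variables, so the count of lattice tableaux
    with given content has to be shown independent of that number. *)

Ltac big_lia :=
  repeat match goal with H : context [@bigop _ _ _ _ _] |- _ => move: H end;
  rewrite /=;
  repeat match goal with
    |- context [@bigop ?R ?I ?x ?s ?F] => generalize (@bigop R I x s F); intro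
  end; lia.

Lemma noninc_leq (f : nat -> nat) i j :
  (forall k, f k.+1 <= f k) -> i <= j -> f j <= f i.
Proof.
move=> mono; elim: j => [|j IH] ij; first by have -> : i = 0 by lia.
by have := mono j; case: (eqVneq i j.+1) => [->//|ne]; have := IH; lia.
Qed.

Lemma geq_trans : transitive geq.
Proof. by move=> y x z; rewrite /geq /=; lia. Qed.

Lemma is_part_noninc s i : is_part s -> nth 0 s i.+1 <= nth 0 s i.
Proof.
case/andP=> srt _; case: (ltnP i.+1 (size s)) => h; last by rewrite (nth_default _ h).
by have := sorted_ltn_nth geq_trans 0 srt i i.+1 (ltnW h) h (ltnSn i).
Qed.

Lemma nth_filter_nz s i : sorted geq s -> nth 0 [seq x <- s | x != 0] i = nth 0 s i.
Proof.
elim: s i => [//|x s IH] i /= ps; have ss := path_sorted ps.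
case: eqP => [x0|_] /=; last by case: i => [//|i] /=; rewrite IH.
have all0 : all (pred1 0) s.
  by apply: sub_all (order_path_min geq_trans ps) => y; rewrite /geq /= x0; lia.
have -> : [seq x <- s | x != 0] = [::].
  apply/eqP; rewrite -[_ == _]negbK -has_filter; apply/hasPn => y ys /=.
  by rewrite negbK; exact: (allP all0).
rewrite nth_nil x0; case: i => [//|i] /=.
case: (ltnP i (size s)) => h; last by rewrite nth_default.
by have /eqP := allP all0 _ (mem_nth 0 h).
Qed.

Lemma sumn_filter_nz s : sumn [seq x <- s | x != 0] = sumn s.
Proof. by elim: s => [//|x s IH] /=; case: eqP => [->|] /=; rewrite IH. Qed.

Lemma is_part_filter s : sorted geq s -> is_part [seq x <- s | x != 0].
Proof.
move=> ss; apply/andP; split; first exact: sorted_filter geq_trans _ _ ss.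
by rewrite mem_filter.
Qed.

Lemma is_part_gt0 s i : is_part s -> i < size s -> 0 < nth 0 s i.
Proof.
by case/andP=> _ n0 h; rewrite lt0n; apply: contraNneq n0 => <-; exact: mem_nth.
Qed.

Lemma is_part_eq s t : is_part s -> is_part t -> (forall i, nth 0 s i = nth 0 t i) -> s = t.
Proof.
move=> ps pt e; apply: (@eq_from_nth _ 0) => //.
case: (ltngtP (size s) (size t)) => // h.
  by have := is_part_gt0 pt h; rewrite -e nth_default.
by have := is_part_gt0 ps h; rewrite e nth_default.
Qed.

Lemma size_le_sumn s : 0 \notin s -> size s <= sumn s.
Proof.
elim: s => [//|x s IH] /=; rewrite inE negb_or => /andP[x0 /IH].
by case: x x0 => //= x _; lia.
Qed.

Lemma nb_nonzero_lt s i : sorted geq s -> (i < nb_nonzero s) = (0 < nth 0 s i).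
Proof.
move=> ss; rewrite /nb_nonzero -size_filter -(nth_filter_nz i ss) lt0n.
case: ltnP => h; last by rewrite nth_default.
by apply/esym; have := mem_nth 0 h; rewrite mem_filter => /andP[].
Qed.

Lemma sorted_geq_nth s : (forall i, nth 0 s i.+1 <= nth 0 s i) -> sorted geq s.
Proof.
move=> h; case: s h => [//|x s] h /=; apply/(pathP 0) => i is_; exact: (h i).
Qed.

Lemma find_iota (a : pred nat) m x : x < m -> a x ->
  (forall y, y < x -> ~~ a y) -> find a (iota 0 m) = x.
Proof.
move=> xm ax nax; have -> : m = x + (m - x.+1).+1 by lia.
rewrite iotaD find_cat size_iota /= ax addn0; case: hasP => // -[y].
by rewrite mem_iota => /andP[_ yx] ay; move: (nax y yx); rewrite ay.
Qed.

Lemma count_add (P Q D : pred nat) s : (forall c, (P c : nat) = Q c + D c) ->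
  count P s = count Q s + count D s.
Proof. by move=> h; elim: s => [//|x s IH] /=; rewrite IH h; lia. Qed.

Lemma sum_nat_itv a b x y : a <= x -> x <= y -> y <= b ->
  \sum_(a <= c < b) ((x <= c) && (c < y) : nat) = y - x.
Proof.
move=> ax xy yb; rewrite (@big_cat_nat _ _ _ x) //=; last lia.
rewrite (@big_cat_nat _ _ _ y x) //=.
rewrite (eq_big_nat _ _ (m := a) (n := x) (F2 := fun _ => 0)); last by move=> i; lia.
rewrite (eq_big_nat _ _ (m := x) (n := y) (F2 := fun _ => 1)); last by move=> i /andP[-> ->].
rewrite (eq_big_nat _ _ (m := y) (n := b) (F2 := fun _ => 0)); last by move=> i; case: (ltnP i y); rewrite ?andbF //; lia.
by rewrite !sum_nat_const_nat; lia.
Qed.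

(** A property closed downwards holds on an initial segment, whose length is the number of places
    where it holds. It is applied to the entries below [k] of a row. *)
Lemma sum_threshold (P : pred nat) a b :
  (forall c c', a <= c -> c <= c' -> c' < b -> P c' -> P c) ->
  forall c, a <= c < b -> P c = (c < a + \sum_(a <= i < b) (P i : nat)).
Proof.
elim: b => [|b IH] dc c cab; first lia.
have ab : a <= b by lia.
rewrite big_nat_recr //=; case Pb: (P b).
  rewrite (eq_big_nat _ _ (F2 := fun _ => 1)); last first.
    by move=> i ib; rewrite (dc i b) //; lia.
  by rewrite (dc c b) // ?sum_nat_const_nat; lia.
rewrite addn0; have IH' := IH (fun i j ai ij jb => dc i j ai ij (ltnW jb)).
case: (eqVneq c b) => [->|cb]; last by apply: IH'; lia.
rewrite Pb; apply/esym/negbTE; rewrite -leqNgt.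
have : \sum_(a <= i < b) (P i : nat) <= \sum_(a <= i < b) 1 by apply: leq_sum => i _; case: (P i).
by rewrite sum_nat_const_nat; lia.
Qed.

(** Reindexing by [h] shows that the sum is its own opposite; the absence of 2-torsion replaces a
    discussion of fixed points. *)
Lemma sum_sign_involution (I : finType) (V : zmodType) (P : pred I) (h : I -> I) (F : I -> V) :
  (forall x : V, x = (- x)%R -> x = 0%R) ->
  (forall i, P i -> P (h i) /\ h (h i) = i) -> (forall i, P i -> F (h i) = (- F i)%R) ->
  (\sum_(i | P i) F i = 0)%R.
Proof.
move=> tf Ph Fh; apply: tf.
rewrite -sumrN {1}(reindex_onto h h); last by move=> i /Ph [].
apply: eq_big => [i|i].
  apply/andP/idP => [[/Ph[+ _] /eqP e]|Pi]; first by rewrite e.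
  by case: (Ph i Pi) => -> ->.
case/andP=> /Ph[+ _] /eqP e; rewrite e => /Fh; done.
Qed.

(** * Gelfand-Tsetlin patterns *)

(** Level [k] is the shape formed by [mu] and the entries [< k]; the last two fields say that
    consecutive levels differ by a horizontal strip. *)
Record gt_pattern (n : nat) (mu la : nat -> nat) (p : nat -> nat -> nat) : Prop := {
  gt_bot : forall r, p 0 r = mu r;
  gt_top : forall r, p n r = la r;
  gt_le : forall k r, k < n -> p k r <= p k.+1 r;
  gt_il : forall k r, k < n -> p k.+1 r.+1 <= p k r }.

(** The number of entries [v] in the columns [< J]: in row [r] they fill the columns from [p v r] up
    to [p v.+1 r]. *)
Definition pat_cnt (R : nat) (p : nat -> nat -> nat) (J v : nat) :=
  \sum_(r < R) (minn J (p v.+1 r) - minn J (p v r)).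

Definition pat_wt (R : nat) (p : nat -> nat -> nat) (v : nat) :=
  \sum_(r < R) (p v.+1 r - p v r).

(* The Bender-Knuth involution on level [k.+1] of the pattern, restricted to
   the columns [>= J]. *)
Definition toggle (J k : nat) (p : nat -> nat -> nat) (k' r : nat) : nat :=
  if (k' == k.+1) && (J <= p k' r) then
    maxn J (maxn (p k r) (p k.+2 r.+1)) +
    (if r is r'.+1 then minn (p k.+2 r) (p k r') else p k.+2 0) - p k.+1 r
  else p k' r.

Section Toggle.
Variables (n : nat) (mu la : nat -> nat) (p : nat -> nat -> nat) (J k : nat).
Hypothesis Hp : gt_pattern n mu la p.
Hypothesis Hk : k.+1 < n.
(** Equivalently, the value [k.+1] does not occur in column [J - 1]. Otherwise a [k] created to the
    right of column [J - 1] could stand behind a [k.+1]. *)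
Hypothesis HJ : forall r, J <= p k.+2 r -> J <= p k.+1 r.

Let le1 r : p k r <= p k.+1 r. Proof. by apply: (gt_le Hp); lia. Qed.
Let le2 r : p k.+1 r <= p k.+2 r. Proof. by apply: (gt_le Hp); lia. Qed.
Let il1 r : p k.+1 r.+1 <= p k r. Proof. by apply: (gt_il Hp); lia. Qed.
Let il2 r : p k.+2 r.+1 <= p k.+1 r. Proof. by apply: (gt_il Hp); lia. Qed.

Lemma toggle_neq k' r : k' != k.+1 -> toggle J k p k' r = p k' r.
Proof. by rewrite /toggle => /negbTE ->. Qed.

Lemma toggle_lo r : p k.+1 r < J -> toggle J k p k.+1 r = p k.+1 r.
Proof. by rewrite /toggle eqxx /=; case: ifP => //; lia. Qed.

Lemma toggle_bounds r : J <= p k.+1 r ->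
  [/\ J <= toggle J k p k.+1 r, p k r <= toggle J k p k.+1 r,
      toggle J k p k.+1 r <= p k.+2 r, p k.+2 r.+1 <= toggle J k p k.+1 r &
      forall r', r = r'.+1 -> toggle J k p k.+1 r <= p k r'].
Proof.
move=> Jr; rewrite /toggle eqxx Jr /=.
have := le1 r; have := le2 r; have := il2 r.
case: r Jr => [|r] Jr a b c; first by split => //; lia.
have := il1 r; have := il2 r => d e; have := HJ (r := r).
by split => [||||r' [<-]]; lia.
Qed.

Lemma toggle_geJ r : (J <= toggle J k p k.+1 r) = (J <= p k.+1 r).
Proof.
case: (leqP J (p k.+1 r)) => h; first by case: (toggle_bounds h).
by rewrite toggle_lo //; lia.
Qed.

Lemma toggle_pattern : gt_pattern n mu la (toggle J k p).
Proof.
split.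
- by move=> r; rewrite toggle_neq ?(gt_bot Hp).
- by move=> r; rewrite toggle_neq ?(gt_top Hp) //; lia.
- move=> k' r lk'; have := gt_le Hp (k := k') r lk'.
  case: (eqVneq k' k.+1) => [->|n1]; last case: (eqVneq k'.+1 k.+1) => [[->]|n2].
  + rewrite (@toggle_neq k.+2); last lia.
    case: (leqP J (p k.+1 r)) => h; last by rewrite toggle_lo.
    by case: (toggle_bounds h).
  + rewrite (@toggle_neq k); last lia.
    case: (leqP J (p k.+1 r)) => h; last by rewrite toggle_lo.
    by case: (toggle_bounds h).
  + by rewrite !toggle_neq.
- move=> k' r lk'; have := gt_il Hp (k := k') r lk'.
  case: (eqVneq k' k.+1) => [->|n1]; last case: (eqVneq k'.+1 k.+1) => [[->]|n2].
  + rewrite (@toggle_neq k.+2); last lia.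
    case: (leqP J (p k.+1 r)) => h; last by rewrite toggle_lo.
    by case: (toggle_bounds h).
  + rewrite (@toggle_neq k); last lia.
    case: (leqP J (p k.+1 r.+1)) => h; last by rewrite toggle_lo.
    by case: (toggle_bounds h) => _ _ _ _ /(_ r erefl).
  + by rewrite !toggle_neq.
Qed.

(** The interval of reflection depends on the levels [k] and [k.+2] only, which stay fixed, and by
    [toggle_geJ] the same rows are reflected again. *)
Lemma toggleK k' r : toggle J k (toggle J k p) k' r = p k' r.
Proof.
rewrite {1}/toggle; case: (eqVneq k' k.+1) => [->|nk] /=; last by rewrite toggle_neq.
rewrite toggle_geJ; case: (leqP J (p k.+1 r)) => h; last by rewrite toggle_lo.
have kne : k != k.+1 by lia.
have kne2 : k.+2 != k.+1 by lia.
rewrite !(toggle_neq _ kne) !(toggle_neq _ kne2).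
have := le1 r; have := le2 r; have := il2 r.
case: r h => [|r] h a b c; rewrite ?(toggle_neq _ kne) /toggle eqxx h /=; first lia.
have := il1 r; have := il2 r; lia.
Qed.

Lemma toggle_min J' k' r : J' <= J -> minn J' (toggle J k p k' r) = minn J' (p k' r).
Proof.
move=> h; case: (eqVneq k' k.+1) => [->|nk]; last by rewrite toggle_neq.
case: (leqP J (p k.+1 r)) => g; last by rewrite toggle_lo.
by case: (toggle_bounds g); lia.
Qed.

Lemma toggle_cnt R J' v : J' <= J -> pat_cnt R (toggle J k p) J' v = pat_cnt R p J' v.
Proof. by move=> h; apply: eq_bigr => r _; rewrite !toggle_min. Qed.

(* Summing the maxima and minima of the toggle over the rows telescopes. *)
Lemma toggle_sum R : p k.+2 R = 0 ->
  \sum_(r < R) (maxn J (toggle J k p k.+1 r) + maxn J (p k.+1 r)) =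
  \sum_(r < R) (maxn J (p k r) + maxn J (p k.+2 r)).
Proof.
(* After truncation by [maxn J] the rows left fixed obey the same formula as the reflected ones: by
   [HJ] every term is [J] there. *)
have loc r : maxn J (toggle J k p k.+1 r) + maxn J (p k.+1 r) =
   maxn (maxn J (p k r)) (maxn J (p k.+2 r.+1)) +
   (if r is r'.+1 then minn (maxn J (p k.+2 r)) (maxn J (p k r'))
    else maxn J (p k.+2 0)).
  rewrite /toggle eqxx /=.
  have := le1 r; have := le2 r; have := il2 r.
  have := HJ (r := r).
  case: r => [|r] hJ a b c; first by case: leqP => ?; lia.
  have := il1 r; have := il2 r => d e.
  by case: leqP => ?; lia.
move=> pR0; under eq_bigr do rewrite loc.
have: forall m, \sum_(r < m.+1) (maxn (maxn J (p k r)) (maxn J (p k.+2 r.+1)) +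
   (if nat_of_ord r is r'.+1 then minn (maxn J (p k.+2 r)) (maxn J (p k r'))
    else maxn J (p k.+2 0))) + maxn J (p k m) =
   \sum_(r < m.+1) (maxn J (p k r) + maxn J (p k.+2 r)) +
    maxn (maxn J (p k m)) (maxn J (p k.+2 m.+1)).
  elim=> [|m IH]; first by rewrite !big_ord_recr !big_ord0 /=; lia.
  by rewrite big_ord_recr [in RHS]big_ord_recr /=; move: IH => /=; lia.
case: R pR0 => [|R] pR0; first by rewrite !big_ord0.
move/(_ R); rewrite pR0 maxn0 maxnAC maxnn.
move/eqP; by rewrite eqn_add2r => /eqP ->.
Qed.

End Toggle.

Section PatternSums.
Variables (n : nat) (mu la : nat -> nat) (p : nat -> nat -> nat) (R : nat).
Hypothesis Hp : gt_pattern n mu la p.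
Hypothesis la0 : forall r, R <= r -> la r = 0.

Lemma gt_leq k k' r : k <= k' -> k' <= n -> p k r <= p k' r.
Proof.
elim: k' => [|k' IH] kk' k'n; first by have -> : k = 0 by lia.
have := gt_le Hp (k := k') r k'n; case: (eqVneq k k'.+1) => [->//|ne].
by have := IH; lia.
Qed.

Lemma gt_out k r : k <= n -> R <= r -> p k r = 0.
Proof. by move=> kn Rr; have := gt_leq r kn (leqnn n); rewrite (gt_top Hp) la0 //; lia. Qed.

Lemma pat_wtE v : v < n -> \sum_(r < R) p v.+1 r = \sum_(r < R) p v r + pat_wt R p v.
Proof.
move=> vn; rewrite -big_split /=; apply: eq_bigr => r _.
by have := gt_le Hp (k := v) r vn; lia.
Qed.

Lemma pat_cntE J v : v < n ->
  \sum_(r < R) minn J (p v.+1 r) = \sum_(r < R) minn J (p v r) + pat_cnt R p J v.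
Proof.
move=> vn; rewrite -big_split /=; apply: eq_bigr => r _.
by have := gt_le Hp (k := v) r vn; lia.
Qed.

(** Length of column [J] in level [k], cells of [mu] included; [v] occurs in this column when it
    grows from level [v] to level [v.+1]. *)
Definition pat_col J k := \sum_(r < R) (J < p k r : nat).

Lemma pat_cntS J v : v < n ->
  pat_cnt R p J.+1 v + pat_col J v = pat_cnt R p J v + pat_col J v.+1.
Proof.
move=> vn; rewrite -!big_split /=; apply: eq_bigr => r _.
have := gt_le Hp (k := v) r vn.
by case: (ltnP J (p v r)) => /=; case: (ltnP J (p v.+1 r)) => /=; lia.
Qed.

Lemma pat_col_mono J v : v < n -> pat_col J v <= pat_col J v.+1.
Proof.
move=> vn; apply: leq_sum => r _; have := gt_le Hp (k := v) r vn.
by case: (ltnP J (p v r)) => /=; case: (ltnP J (p v.+1 r)) => /=; lia.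
Qed.

(** A value occurs at most once in a column: by interlacing, a row [r.+1] that reaches beyond [J] at
    level [v.+1] forces row [r] to do so at level [v]. *)
Lemma pat_col_step J v : v < n -> pat_col J v.+1 <= (pat_col J v).+1.
Proof.
move=> vn; rewrite /pat_col; case: R => [|R']; first by rewrite !big_ord0.
have h : \sum_(i < R') (J < p v i : nat) <= \sum_(i < R'.+1) (J < p v i : nat).
  by rewrite big_ord_recr /= leq_addr.
apply: leq_trans (_ : 1 + _ <= _); last by rewrite add1n ltnS; exact: h.
rewrite big_ord_recl; apply: leq_add; first by case: ltnP.
apply: leq_sum => r _; rewrite lift0; have := gt_il Hp (k := v) r vn.
by case: (ltnP J (p v r)) => /=; case: (ltnP J (p v.+1 r.+1)) => /=; lia.
Qed.

(* In the leftmost column where the lattice condition fails for [v], the value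
   [v] occurs and [v.+1] does not; this is what allows toggling to its right. *)
Lemma pat_first_bad J v : v.+1 < n ->
  pat_cnt R p J v <= pat_cnt R p J v.+1 ->
  pat_cnt R p J.+1 v.+1 < pat_cnt R p J.+1 v ->
  pat_cnt R p J.+1 v = (pat_cnt R p J.+1 v.+1).+1 /\
  (forall r, J.+1 <= p v.+2 r -> J.+1 <= p v.+1 r).
Proof.
move=> vn c1 c2; have vn' : v < n by lia.
have := pat_cntS J vn; have := pat_cntS J vn'.
have := pat_col_mono J vn; have := pat_col_mono J vn'; have := pat_col_step J vn'.
move=> e1 e2 e3 e4 e5.
have eqc : pat_col J v.+1 = pat_col J v.+2 by lia.
split; first lia.
move=> r; case: (leqP R r) => [Rr|rR]; first by rewrite gt_out //; lia.
have : \sum_(r < R) ((J < p v.+2 r : nat) - (J < p v.+1 r)) == 0.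
  rewrite sumnB; first by rewrite -/(pat_col J v.+1) eqc subnn.
  move=> i _; have := gt_le Hp (k := v.+1) i vn.
  by case: (ltnP J (p v.+1 i)) => /=; case: (ltnP J (p v.+2 i)) => /=; lia.
rewrite sum_nat_eq0 => /forallP /(_ (Ordinal rR)) /=.
by case: (ltnP J (p v.+2 r)); case: (ltnP J (p v.+1 r)).
Qed.

Lemma pat_cnt_big J v : v < n -> (forall r, la r <= J) -> pat_cnt R p J v = pat_wt R p v.
Proof.
move=> vn laJ; apply: eq_bigr => r _.
have := gt_leq r vn (leqnn n); have := gt_le Hp (k := v) r vn.
by rewrite (gt_top Hp); have := laJ r; lia.
Qed.

(** In the columns [>= J] the numbers of [k] and [k.+1] are exchanged, while the surplus [d] of [k]
    in the columns [< J] remains. With [d = 0] this gives symmetry, with [d = 1] the sign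
    reversal. *)
Lemma toggle_wt J k d : k.+1 < n ->
  (forall r, J <= p k.+2 r -> J <= p k.+1 r) ->
  pat_cnt R p J k = pat_cnt R p J k.+1 + d ->
  [/\ pat_wt R (toggle J k p) k = pat_wt R p k.+1 + d,
      pat_wt R (toggle J k p) k.+1 + d = pat_wt R p k &
      forall v, v != k -> v != k.+1 -> pat_wt R (toggle J k p) v = pat_wt R p v].
Proof.
move=> kn HJ cd.
have Hp' := toggle_pattern Hp kn HJ; have kn' : k < n by lia.
split; last first.
  by move=> v n1 n2; apply: eq_bigr => r _; rewrite !toggle_neq; lia.
all: have ts := toggle_sum Hp kn HJ (gt_out kn (leqnn R)).
(* Cuts every row at column [J], which turns the truncated sums of [toggle_sum] into contents. *)
all: have mm f : \sum_(r < R) maxn J (f r) + \sum_(r < R) minn J (f r) =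
    \sum_(r < R) J + \sum_(r < R) f r
  by rewrite -!big_split /=; apply: eq_bigr => r _; rewrite addnC minnC maxnC addn_min_max addnC.
all: rewrite !big_split /= in ts.
all: have m1 := mm (fun r => toggle J k p k.+1 r); have m2 := mm (fun r => p k.+1 r).
all: have m3 := mm (fun r => p k r); have m4 := mm (fun r => p k.+2 r).
all: have w1 := pat_wtE kn; have w2 := pat_wtE kn'.
all: have c1 := pat_cntE J kn; have c2 := pat_cntE J kn'.
all: have e1 : \sum_(r < R) minn J (toggle J k p k.+1 r) = \sum_(r < R) minn J (p k.+1 r)
  by apply: eq_bigr => r _; rewrite (toggle_min Hp kn HJ).
all: have v1 : \sum_(r < R) toggle J k p k.+1 r =
    \sum_(r < R) p k r + pat_wt R (toggle J k p) k.
1,3: rewrite -big_split /=; apply: eq_bigr => r _; have := gt_le Hp' (k := k) r kn';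
  by rewrite (@toggle_neq p J k k); lia.
all: have v2 : \sum_(r < R) p k.+2 r =
    \sum_(r < R) toggle J k p k.+1 r + pat_wt R (toggle J k p) k.+1.
1,3: rewrite -big_split /=; apply: eq_bigr => r _; have := gt_le Hp' (k := k.+1) r kn;
  by rewrite (@toggle_neq p J k k.+2); lia.
all: move: m1 m2 m3 m4 => /= m1 m2 m3 m4.
all: big_lia.
Qed.

Lemma pat_colE J k r : (forall i, p k i.+1 <= p k i) -> p k R = 0 ->
  (J < p k r) = (r < pat_col J k).
Proof.
move=> mono pR0.
have noninc i j : i <= j -> p k j <= p k i.
  exact: (noninc_leq (f := p k)).
have: exists m, m <= R /\ forall i, (J < p k i) = (i < m).
  case: (@ex_minnP (fun i => p k i <= J)); first by exists R; rewrite pR0.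
  move=> m hm min; exists m; split; first by apply: min; rewrite pR0.
  move=> i; case: (ltnP i m) => im; last by have := noninc _ _ im; lia.
  by case: (leqP (p k i) J) => // /min; lia.
case=> m [mR Hm]; rewrite Hm; congr (r < _).
rewrite /pat_col; under eq_bigr do rewrite Hm.
rewrite -(big_mkord xpredT (fun i => (i < m : nat))) (@big_cat_nat _ _ _ m) //=.
rewrite (eq_big_nat _ _ (F2 := fun _ => 1)); last by move=> i /andP[_ ->].
rewrite (eq_big_nat _ _ (F2 := fun _ => 0) (m := m)) ?sum_nat_const_nat; first lia.
by move=> i; case: ltnP; lia.
Qed.

Lemma gt_noninc k i : (forall j, la j.+1 <= la j) -> k <= n -> p k i.+1 <= p k i.
Proof.
move=> lam kn; case: (eqVneq k n) => [->|ne]; first by rewrite !(gt_top Hp).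
have := gt_le Hp (k := k) i.+1; have := gt_il Hp (k := k) i; lia.
Qed.

End PatternSums.

(** * Lattice patterns of straight shape *)

Section Straight.
Variables (n : nat) (la : nat -> nat) (p : nat -> nat -> nat) (R : nat).
Hypothesis Hp : gt_pattern n (fun _ => 0) la p.
Hypothesis la0 : forall r, R <= r -> la r = 0.
Hypothesis lam : forall j, la j.+1 <= la j.
Hypothesis good : forall J v, v.+1 < n -> pat_cnt R p J v <= pat_cnt R p J v.+1.

(** Induction on the number of columns: the lattice condition forces a column of length [h] to
    contain exactly the [h] largest values. Once the first [J] columns are known, the counts in them
    telescope to [minn J (p v.+1 0)]. *)
Lemma straight_min J k r : k < n -> minn J (p k r) = minn J (p k.+1 r.+1).
Proof.
elim: J k r => [|J IH] k r kn; first by lia.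
have cntJ v : v < n -> pat_cnt R p J v = minn J (p v.+1 0).
  move=> vn; rewrite /pat_cnt.
  rewrite (eq_bigr (fun i : 'I_R => minn J (p v.+1 i) - minn J (p v.+1 i.+1))); last first.
    by move=> i _; rewrite (IH v).
  have: forall m, \sum_(r < m) (minn J (p v.+1 r) - minn J (p v.+1 r.+1)) + minn J (p v.+1 m) = minn J (p v.+1 0).
    elim=> [|m IHm]; first by rewrite big_ord0.
    rewrite big_ord_recr /=; have := gt_noninc Hp m lam vn; big_lia.
  by move=> /(_ R); rewrite (gt_out Hp la0) // ?minn0 ?addn0 //; lia.
have colS v : v < n -> 0 < pat_col p R J v -> pat_col p R J v.+1 = (pat_col p R J v).+1.
  move=> vn c0.
  have := pat_col_mono R Hp J vn; have := pat_col_step R Hp J vn => s1 s2.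
  case: (eqVneq (pat_col p R J v.+1) (pat_col p R J v)) => [eqc|]; last lia.
  exfalso.
  have c00 : pat_col p R J 0 = 0.
    by rewrite /pat_col big1 // => i _; rewrite (gt_bot Hp).
  (* If column [J] has a gap, some [w] occurs in it and [w.+1] does not. Both values occur [J] times
     in the first [J] columns, so [good] fails for [J.+1] columns. *)
  have: exists w, [/\ w < v, pat_col p R J w < pat_col p R J w.+1, 0 < pat_col p R J w.+1 &
          pat_col p R J w.+2 = pat_col p R J w.+1].
    elim: v vn c0 eqc {s1 s2} => [|v IHv] vn c0 eqc; first by rewrite c00 in c0.
    have vn' : v < n by lia.
    have := pat_col_mono R Hp J vn'; rewrite leq_eqVlt => /orP[/eqP e|lt].
      case: IHv => // [|w [*]]; first by rewrite e.
      by exists w; split => //; lia.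
    by exists v; split.
  case=> w [wv w1 w2 w3].
  have wn1 : w.+1 < n by lia.
  have wn0 : w < n by lia.
  have := good J.+1 wn1; have := pat_cntS R Hp J wn1; have := pat_cntS R Hp J wn0.
  rewrite !cntJ //.
  have h1 : J < p w.+1 0.
    rewrite (@pat_colE p R J w.+1) //; last by rewrite (gt_out Hp la0) //; lia.
    by move=> i; apply: (gt_noninc Hp _ lam); lia.
  have := gt_le Hp (k := w.+1) 0 wn1.
  lia.
have pc v : v <= n -> forall r, (J < p v r) = (r < pat_col p R J v).
  move=> vn r'; apply: pat_colE; last by rewrite (gt_out Hp la0).
  by move=> i; apply: (gt_noninc Hp _ lam); lia.
have e1 := pc _ (ltnW kn) r; have e2 := pc _ kn r.+1.
have := colS k kn; have := IH k r kn; have := gt_il Hp (k := k) r kn.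
by move: e1 e2; case: (ltnP J (p k r)); case: (ltnP J (p k.+1 r.+1)); lia.
Qed.

Lemma straight_shift k r : k < n -> p k r = p k.+1 r.+1.
Proof. by move=> kn; have := straight_min (p k r + p k.+1 r.+1) r kn; lia. Qed.

Lemma straight_pattern k r : k <= n -> p k r = la (r + (n - k)).
Proof.
move=> kn; have [d nE] : exists d, n = k + d by exists (n - k); lia.
elim: d k r kn nE => [|d IH] k r kn nE.
  by rewrite -[RHS](gt_top Hp); congr (p _ _); lia.
rewrite straight_shift; last by lia.
by rewrite IH; [congr la; lia | lia | lia].
Qed.

Lemma straight_wt v : v < n -> pat_wt R p v = la (n - v.+1).
Proof.
move=> vn; rewrite /pat_wt.
have: forall m, \sum_(r < m) (p v.+1 r - p v r) + p v.+1 m = p v.+1 0.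
  elim=> [|m IHm]; first by rewrite big_ord0.
  rewrite big_ord_recr /= (straight_shift m vn).
  have := gt_noninc Hp m lam vn; big_lia.
move/(_ R); rewrite (gt_out Hp la0) // addn0 => ->.
by rewrite straight_pattern.
Qed.

End Straight.

(** Existence of the pattern that [straight_pattern] forces; [la n = 0], at most [n] rows, makes its
    bottom level empty. *)
Lemma straight_pattern_good n la R : (forall j, la j.+1 <= la j) ->
  (forall r, R <= r -> la r = 0) -> la n = 0 ->
  let p k r := la (r + (n - k)) in
  gt_pattern n (fun _ => 0) la p /\
  (forall J v, v.+1 < n -> pat_cnt R p J v <= pat_cnt R p J v.+1).
Proof.
move=> lam la0 lan p.
have noninc i j : i <= j -> la j <= la i.
  exact: noninc_leq.
have Hp : gt_pattern n (fun _ => 0) la p.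
  split.
  - by move=> r; rewrite /p; have := @noninc n (r + (n - 0)); lia.
  - by move=> r; rewrite /p subnn addn0.
  - by move=> k r kn; apply: noninc; lia.
  - by move=> k r kn; apply: noninc; lia.
split=> // J v vn.
have cnt w : w < n -> pat_cnt R p J w = minn J (p w.+1 0).
  move=> wn; rewrite /pat_cnt.
  have E i : p w i = p w.+1 i.+1 by rewrite /p; congr la; lia.
  have: forall m, \sum_(r < m) (minn J (p w.+1 r) - minn J (p w r)) + minn J (p w.+1 m) = minn J (p w.+1 0).
    elim=> [|m IHm]; first by rewrite big_ord0.
    rewrite big_ord_recr /= E; have := gt_noninc Hp m lam wn; big_lia.
  by move=> /(_ R); rewrite (gt_out Hp la0) // ?minn0 ?addn0 //; lia.
rewrite !cnt; [|lia..].
have := gt_le Hp (k := v.+1) 0 vn; lia.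
Qed.

(** * Tableaux and patterns *)

Section Cells.
Variables (la mu : seq nat).

Definition crow (b : cell la mu) : nat := (val b).1.
Definition ccol (b : cell la mu) : nat := (val b).2.

Lemma cellP (b : cell la mu) : in_skew la mu (crow b) (ccol b).
Proof. exact: (valP b). Qed.

Lemma cell_inj (b b' : cell la mu) : crow b = crow b' -> ccol b = ccol b' -> b = b'.
Proof.
move=> h1 h2; apply: val_inj; move: h1 h2; rewrite /crow /ccol.
by case: (val b) (val b') => [x y] [x' y'] /= /val_inj -> /val_inj ->.
Qed.

Section Filling.
Variable n : nat.
Implicit Type T : {ffun cell la mu -> 'I_n}.

Lemma ssyt_row T a b : is_ssyt T -> crow a = crow b -> ccol a <= ccol b -> T a <= T b.
Proof.
move=> /forallP /(_ a) /forallP /(_ b) /andP[/implyP h _] e.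
rewrite leq_eqVlt => /orP[/eqP e'|lt]; first by rewrite (cell_inj e e').
by apply: h; rewrite lt andbT; apply/eqP/val_inj.
Qed.

Lemma ssyt_col T a b : is_ssyt T -> ccol a = ccol b -> crow a < crow b -> T a < T b.
Proof.
move=> /forallP /(_ a) /forallP /(_ b) /andP[_ /implyP h] e lt.
by apply: h; rewrite -/(crow a) lt andbT; apply/eqP/val_inj.
Qed.

(* [T] and [p] describe the same filling: row [r] of level [k] of the pattern
   ends where the entries [< k] of row [r] of [T] end. *)
Definition compat T (p : nat -> nat -> nat) : bool :=
  [forall b, forall k : 'I_n.+1, (T b < k) == (ccol b < p k (crow b))].

Lemma compatP T p : reflect (forall b k, k <= n -> (T b < k) = (ccol b < p k (crow b))) (compat T p).
Proof.
apply: (iffP forallP) => h b.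
  move=> k kn; have /forallP := h b.
  by move=> /(_ (Ordinal (kn : k < n.+1))) /eqP.
by apply/forallP=> k; apply/eqP/h; rewrite -ltnS.
Qed.

Lemma compat_uniq T T' p : compat T p -> compat T' p -> T = T'.
Proof.
move=> /compatP h /compatP h'; apply/ffunP=> b; apply: val_inj.
have := h b (T b).+1 (ltn_ord _); rewrite -h' ?ltn_ord //.
have := h b (T' b).+1 (ltn_ord _); rewrite -h' ?ltn_ord //.
by rewrite /=; lia.
Qed.

(** The default [n] exceeds all entries, so a position without a cell never counts as an entry below
    some [k <= n]. *)
Definition tab_val T r c : nat :=
  if [pick b : cell la mu | (crow b == r) && (ccol b == c)] is Some b then T b else n.

Lemma tab_valE T b : tab_val T (crow b) (ccol b) = T b.
Proof.
rewrite /tab_val; case: pickP => [b' /andP[/eqP e /eqP e']|/(_ b)]; first by rewrite (cell_inj e e').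
by rewrite !eqxx.
Qed.

Definition tab_pat T k r : nat :=
  nth 0 mu r + \sum_(nth 0 mu r <= c < nth 0 la r) (tab_val T r c < k : nat).

Definition tab_cnt T J v := #|[pred b : cell la mu | (ccol b < J) && (T b == v :> nat)]|.
Definition tab_wt T v := #|[pred b : cell la mu | T b == v :> nat]|.

End Filling.
End Cells.

Section SkewCells.
Variables (la mu : seq nat).
Hypothesis Hs : skew_shape la mu.

Let lapart : is_part la. Proof. by case: Hs. Qed.
Let mupart : is_part mu. Proof. by case: Hs. Qed.
Let mula r : nth 0 mu r <= nth 0 la r. Proof. by case: Hs. Qed.

Lemma la_head r : nth 0 la r <= head 0 la.
Proof.
rewrite -nth0; apply: (noninc_leq (f := nth 0 la)) => // k.
exact: is_part_noninc.
Qed.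

Lemma cell_ex r c : in_skew la mu r c -> exists b : cell la mu, crow b = r /\ ccol b = c.
Proof.
move=> h; have /andP[h1 h2] := h.
have rR : r < size la by rewrite ltnNge; apply/negP=> /(nth_default 0); lia.
have cM : c < head 0 la by have := la_head r; lia.
by exists (Sub (Ordinal rR, Ordinal cM) h).
Qed.

Lemma sum_cell (F : nat -> nat -> nat) :
  \sum_(b : cell la mu) F (crow b) (ccol b) =
  \sum_(r < size la) \sum_(nth 0 mu r <= c < nth 0 la r) F r c.
Proof.
transitivity (\sum_(x : 'I_(size la) * 'I_(head 0 la) | in_skew la mu x.1 x.2) F x.1 x.2).
  rewrite [RHS](reindex_omap (fun b : cell la mu => val b) insub) /=; last first.
    by move=> i Pi; rewrite insubT.
  apply: eq_bigl => b; rewrite (valP b) /=.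
  by apply/esym/eqP; exact: valK.
rewrite -(pair_big_dep xpredT (fun (r : 'I__) (c : 'I__) => in_skew la mu r c) (fun r c => F r c)) /=.
apply: eq_bigr => r _; rewrite (big_nat_widen _ _ (head 0 la)) ?la_head //.
rewrite (big_nat_widenl _ 0) // big_mkord.
by apply: eq_bigl => c; rewrite /in_skew andbC.
Qed.

Section Fill.
Variable n : nat.
Implicit Type T : {ffun cell la mu -> 'I_n}.

Lemma tab_patP T : is_ssyt T -> compat T (tab_pat T).
Proof.
move=> sT; apply/compatP=> b k kn; rewrite -tab_valE.
apply: (sum_threshold (P := fun c => tab_val T (crow b) c < k)); last exact: cellP.
move=> c c' h1 h2 h3.
have [|b1 [r1 c1]] := @cell_ex (crow b) c; first by rewrite /in_skew; lia.
have [|b2 [r2 c2]] := @cell_ex (crow b) c'; first by rewrite /in_skew; lia.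
rewrite -{1}r2 -c2 -r1 -c1 !tab_valE.
by apply: leq_ltn_trans; apply: ssyt_row => //; lia.
Qed.

Lemma tab_pat_gt T : is_ssyt T -> gt_pattern n (nth 0 mu) (nth 0 la) (tab_pat T).
Proof.
move=> sT; have /compatP cT := tab_patP sT.
have bnd k r : tab_pat T k r <= nth 0 la r.
  rewrite /tab_pat; have : \sum_(nth 0 mu r <= c < nth 0 la r) (tab_val T r c < k : nat)
     <= \sum_(nth 0 mu r <= c < nth 0 la r) 1 by apply: leq_sum => i _; case: ltnP.
  by rewrite sum_nat_const_nat; have := mula r; lia.
split.
- by move=> r; rewrite /tab_pat big1 ?addn0 // => i _; lia.
- move=> r; rewrite /tab_pat (eq_big_nat _ _ (F2 := fun _ => 1)).
    by rewrite sum_nat_const_nat; have := mula r; lia.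
  move=> c hc; have [b [<- <-]] := @cell_ex r c hc.
  by rewrite tab_valE ltn_ord.
- move=> k r kn; rewrite leq_add2l; apply: leq_sum => c _.
  by case: (ltnP (tab_val T r c) k) => //= h; case: ltnP => //; lia.
- move=> k r kn; rewrite leqNgt; apply/negP=> lt.
  (* If interlacing fails, the cell [(r, x)] with an entry [>= k] stands above the cell [(r.+1, x)]
     with an entry [<= k]. *)
  set x := tab_pat T k r in lt.
  have mx : nth 0 mu r <= x by rewrite /x /tab_pat leq_addr.
  have := bnd k.+1 r.+1; have := is_part_noninc r lapart; have := is_part_noninc r mupart.
  move=> i1 i2 i3.
  have [|b1 [r1 c1]] := @cell_ex r x; first by rewrite /in_skew; lia.
  have [|b2 [r2 c2]] := @cell_ex r.+1 x; first by rewrite /in_skew; lia.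
  have := cT b1 k (ltnW kn); have := cT b2 k.+1 kn.
  rewrite r1 c1 r2 c2 lt -/x ltnn.
  have := ssyt_col (a := b1) (b := b2) sT; rewrite c1 c2 r1 r2 => /(_ erefl (ltnSn _)).
  by lia.
Qed.

Lemma compat_ssyt T p : gt_pattern n (nth 0 mu) (nth 0 la) p -> compat T p -> is_ssyt T.
Proof.
move=> Hp /compatP h; apply/forallP=> a; apply/forallP=> b; apply/andP; split.
  apply/implyP => /andP[/eqP e lt].
  have e' : crow a = crow b by rewrite /crow e.
  rewrite -ltnS h // e'; have := h b (T b).+1 (ltn_ord _); rewrite ltnSn => /esym.
  by move: lt; rewrite -/(ccol a) -/(ccol b); lia.
apply/implyP => /andP[/eqP e lt].
have e' : ccol a = ccol b by rewrite /ccol e.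
rewrite h; last exact: ltnW.
have := h b (T b).+1 (ltn_ord _); rewrite ltnSn e' => /esym.
move: lt; rewrite -/(crow a) -/(crow b).
case rb: (crow b) => [//|r] lt.
have := gt_il Hp r (ltn_ord (T b)).
have : p (T b) r <= p (T b) (crow a).
  apply: (noninc_leq (f := p (T b))) => // i.
  apply: (gt_noninc Hp); last exact: ltnW.
  by move=> j; apply: is_part_noninc.
by lia.
Qed.

Lemma compat_ex p : gt_pattern n (nth 0 mu) (nth 0 la) p -> exists T, compat T p.
Proof.
move=> Hp.
have /fin_all_exists [f hf] : forall b : cell la mu, exists j : 'I_n,
    forall k, k <= n -> (j < k) = (ccol b < p k (crow b)).
  move=> b; have /andP[h1 h2] := cellP b.
  (* The entry of a cell is one less than the first level covering it; level 0 is [mu] and covers no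
     cell. *)
  case: (@ex_minnP (fun k => ccol b < p k (crow b))).
    by exists n; rewrite (gt_top Hp).
  case=> [|m] hm min; first by move: hm; rewrite (gt_bot Hp); lia.
  have mn : m < n by apply: min; rewrite (gt_top Hp).
  exists (Ordinal mn) => k kn /=; case: (ltnP m k) => mk.
    by have := gt_leq Hp (crow b) mk kn; lia.
  by apply/esym/negbTE/negP => /min; lia.
by exists (finfun f); apply/compatP=> b k kn; rewrite ffunE hf.
Qed.

Lemma compat_pat T p : gt_pattern n (nth 0 mu) (nth 0 la) p -> compat T p ->
  forall k r, k <= n -> tab_pat T k r = p k r.
Proof.
move=> Hp cT k r kn; have sT := compat_ssyt Hp cT.
have cT' := tab_patP sT; have Hp' := tab_pat_gt sT.
move/compatP: cT => cT; move/compatP: cT' => cT'.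
have := gt_leq Hp r kn (leqnn n); have := gt_leq Hp r (leq0n k) kn.
have := gt_leq Hp' r kn (leqnn n); have := gt_leq Hp' r (leq0n k) kn.
rewrite (gt_bot Hp) (gt_bot Hp') (gt_top Hp) (gt_top Hp') => i1 i2 i3 i4.
case: (ltngtP (tab_pat T k r) (p k r)) => // lt.
  have [|b [br bc]] := @cell_ex r (tab_pat T k r); first by rewrite /in_skew; lia.
  by have := cT b k kn; have := cT' b k kn; rewrite br bc; lia.
have [|b [br bc]] := @cell_ex r (p k r); first by rewrite /in_skew; lia.
by have := cT b k kn; have := cT' b k kn; rewrite br bc; lia.
Qed.

Lemma tab_cntE T p J v : gt_pattern n (nth 0 mu) (nth 0 la) p -> compat T p -> v < n ->
  tab_cnt T J v = pat_cnt (size la) p J v.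
Proof.
move=> Hp /compatP cT vn; rewrite /tab_cnt -sum1_card big_mkcond /=.
rewrite (eq_bigr (fun b => (ccol b < J) && ((p v (crow b) <= ccol b) && (ccol b < p v.+1 (crow b))) : nat)); last first.
  move=> b _; rewrite inE [p v _ <= _]leqNgt -(cT b v (ltnW vn)) -(cT b v.+1 vn).
  have -> : (T b == v :> nat) = ~~ (T b < v) && (T b < v.+1) by lia.
  by case: (_ && _).
rewrite (sum_cell (fun r c => (c < J) && ((p v r <= c) && (c < p v.+1 r)) : nat)).
apply: eq_bigr => r _.
have := gt_leq Hp r vn (leqnn n); have := gt_leq Hp r (leq0n v) (ltnW vn).
have := gt_le Hp r vn.
rewrite (gt_bot Hp) (gt_top Hp) => i1 i2 i3.
rewrite (eq_bigr (fun c => (minn J (p v r) <= c) && (c < minn J (p v.+1 r)) : nat)); last first.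
  by move=> c _; congr nat_of_bool; case: (ltnP c J) => h /=; lia.
case: (leqP (p v r) J) => h.
  by rewrite sum_nat_itv; lia.
rewrite big1 => [|c _]; first lia.
by case: leqP => //=; lia.
Qed.

Lemma tab_cnt_big T v : tab_cnt T (head 0 la) v = tab_wt T v.
Proof.
apply: eq_card => b; rewrite !inE; case/andP: (cellP b) => _ h.
by rewrite (leq_trans h (la_head _)).
Qed.

Lemma tab_wtE T p v : gt_pattern n (nth 0 mu) (nth 0 la) p -> compat T p -> v < n ->
  tab_wt T v = pat_wt (size la) p v.
Proof.
move=> Hp cT vn; rewrite -tab_cnt_big (tab_cntE _ Hp cT vn).
by apply: (pat_cnt_big _ Hp) => // r; exact: la_head.
Qed.

End Fill.
End SkewCells.

(** * Alternants and the Littlewood-Richardson rule *)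

Section Alternant.
Variable n : nat.
Implicit Type m : 'X_{1..n}.

Definition alt m : {mpoly int[n]} :=
  (\sum_(s : 'S_n) (-1) ^+ s *: msym s 'X_[m])%R.

Definition mrho : 'X_{1..n} := [multinom (i : nat) | i < n].

Lemma alt_perm m (s : 'S_n) : alt [multinom m (s i) | i < n] = ((-1) ^+ s *: alt m)%R.
Proof.
rewrite /alt scaler_sumr (reindex_inj (mulgI s)) /=; apply: eq_bigr => t _.
have -> : 'X_[[multinom m (s i) | i < n]] = msym (s^-1)%g 'X_[m] :> {mpoly int[n]}.
  by rewrite msymX invgK.
by rewrite -msymMm mulKg odd_permM signr_addb scalerA.
Qed.

Lemma alt_mul_sym m (p : {mpoly int[n]}) : p \is symmetric ->
  (alt m * p = \sum_(s : 'S_n) (-1) ^+ s *: msym s ('X_[m] * p))%R.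
Proof.
move=> /issymP sp; rewrite /alt mulr_suml; apply: eq_bigr => s _.
by rewrite msymM sp scalerAl.
Qed.

(** A permutation that carries one strictly increasing exponent to another is increasing, hence
    [>= j] at every [j], and comparing sums makes it the identity. So one coefficient recognises an
    alternant. *)
Lemma mcoeff_alt m m' : (forall i j : 'I_n, i < j -> m i < m j) ->
  (forall i j : 'I_n, i < j -> m' i < m' j) ->
  ((alt m)@_m' = (m == m')%:R)%R.
Proof.
move=> sm sm'; rewrite /alt raddf_sum /= (bigD1 1%g) //= odd_perm1 expr0 scale1r msym1m mcoeffX.
rewrite big1 ?addr0 // => s s1; rewrite mcoeffZ msymX mcoeffX.
case: eqP => [e|]; last by rewrite mulr0.
case/negP: s1; apply/eqP/permP => i; rewrite perm1.
have inc (i1 j1 : 'I_n) : i1 < j1 -> (s^-1)%g i1 < (s^-1)%g j1.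
  move=> ij; rewrite ltnNge leq_eqVlt; apply/negP => /orP[/eqP h|h].
    by have /perm_inj e' := val_inj h; rewrite e' ltnn in ij.
  have := sm' _ _ ij; rewrite -e !mnmE => h'.
  by have := sm _ _ h; lia.
have ge (j : 'I_n) : j <= (s^-1)%g j.
  case: j => j jn; elim: j jn => [//|j IH] jn.
  have jn' : j < n by lia.
  apply: leq_ltn_trans (IH jn') _.
  exact: inc.
have suminv : \sum_(j < n) (s^-1)%g j = \sum_(j < n) j.
  by rewrite [RHS](reindex_inj (@perm_inj _ (s^-1)%g)).
have: \sum_(j < n) ((s^-1)%g j - j) == 0.
  by rewrite sumnB // suminv subnn.
rewrite sum_nat_eq0 => /forallP h.
have e1 j : (s^-1)%g j = j.
  by apply/val_inj/eqP; rewrite eqn_leq ge andbT -subn_eq0; have := h j.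
by rewrite -{1}(e1 i) permKV.
Qed.

Lemma mrho_inc (f : nat -> nat) : (forall i j, i <= j -> j < n -> f i <= f j) ->
  forall i j : 'I_n, i < j ->
  ([multinom f i | i < n] + mrho)%MM i < ([multinom f i | i < n] + mrho)%MM j.
Proof.
by move=> mf i j ij; rewrite !mnmDE !mnmE; have := mf i j (ltnW ij) (ltn_ord j); lia.
Qed.

Lemma alt_rho_neq0 : alt mrho != 0%R.
Proof.
apply/eqP => /(congr1 (mcoeff mrho)).
rewrite mcoeff_alt ?eqxx ?mcoeff0 //; try by move=> i j; rewrite !mnmE.
Qed.

End Alternant.

(** Bender-Knuth involutions exchange neighbouring values only; the other transpositions are
    obtained by conjugation with adjacent ones. *)
Lemma sym_adjacent n (p : {mpoly int[n]}) :
  (forall i j : 'I_n, j = i.+1 :> nat -> msym (tperm i j) p = p) -> p \is symmetric.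
Proof.
move=> adj.
have tp d : forall i j : 'I_n, j = i + d :> nat -> msym (tperm i j) p = p.
  elim: d => [|d IH] i j ij.
    have -> : j = i by apply: val_inj; rewrite /= ij addn0.
    by rewrite tperm1 msym1m.
  case: (eqVneq d 0) => [d0|d0]; first by apply: adj; lia.
  have jn : i + d < n by have := ltn_ord j; lia.
  pose k := Ordinal jn.
  have ik : i != k by rewrite -val_eqE /=; lia.
  have jk : j != k by rewrite -val_eqE /=; lia.
  have ijn : i != j by rewrite -val_eqE /=; lia.
  have -> : tperm i j = (tperm k j * tperm i k * tperm k j)%g.
    by rewrite -{1}(tpermV k j) -mulgA -conjgE tpermJ tpermL tpermD // eq_sym.
  have e1 : msym (tperm k j) p = p by apply: adj => /=; lia.
  by rewrite !msymMm e1 IH.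
apply/issymP => s; have [ts -> _] := prod_tpermP s.
elim: ts => [|t ts IH]; first by rewrite big_nil msym1m.
rewrite big_cons msymMm; suff -> : msym (tperm t.1 t.2) p = p by [].
case: (leqP t.1 t.2) => h; first by apply: (tp (t.2 - t.1)); lia.
by rewrite tpermC; apply: (tp (t.1 - t.2)); lia.
Qed.

Lemma mpoly_int_tf n (x : {mpoly int[n]}) : x = (- x)%R -> x = 0%R.
Proof.
move=> e; apply/mpolyP => m; rewrite mcoeff0.
have := congr1 (mcoeff m) e; rewrite mcoeffN => /eqP.
by rewrite -addr_eq0 -mulr2n mulrn_eq0 /= => /eqP.
Qed.

(** * Stembridge's sign-reversing involution on tableaux *)

Section Stembridge.
Variables (la mu : seq nat).
Hypothesis Hs : skew_shape la mu.
Variable n : nat.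
Implicit Type T : {ffun cell la mu -> 'I_n}.
Local Notation R := (size la).

Definition mwt T : 'X_{1..n} := [multinom tab_wt T i | i < n].

Lemma prod_mwt T : (\prod_(b : cell la mu) 'X_(T b) = 'X_[mwt T] :> {mpoly int[n]})%R.
Proof.
rewrite -(big_map (fun b => U_(T b)%MM) xpredT (fun m => 'X_[m]))%R mpolyX_prod; congr mpolyX.
apply/mnmP => i; rewrite mnm_sumE big_map mnmE /tab_wt -sum1_card [RHS]big_mkcond /=.
by apply: eq_bigr => b _; rewrite mnm1E inE -val_eqE; case: eqP.
Qed.

Lemma skew_schurE : (skew_schur n la mu = \sum_(T | is_ssyt T) 'X_[mwt T])%R.
Proof. by apply: eq_bigr => T _; rewrite prod_mwt. Qed.

(** Transports the toggle to fillings; by [compat_uniq] at most one filling can be picked, and under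
    the hypotheses of [flipP] there is one. *)
Definition flip J k T := odflt T [pick T' | compat T' (toggle J k (tab_pat T))].

Lemma toggle_ext J k p p' : k.+1 < n -> (forall k' r, k' <= n -> p k' r = p' k' r) ->
  forall k' r, k' <= n -> toggle J k p k' r = toggle J k p' k' r.
Proof.
move=> kn e k' r kn'; rewrite /toggle (e k') // (e k.+1) 1?(ltnW kn) //.
by case: r => [|r]; rewrite !(e k.+2) // !(e k) //; lia.
Qed.

Lemma la_out r : R <= r -> nth 0 la r = 0. Proof. exact: nth_default. Qed.

Lemma flipP J k T : is_ssyt T -> k.+1 < n ->
  (forall r, J <= tab_pat T k.+2 r -> J <= tab_pat T k.+1 r) ->
  [/\ is_ssyt (flip J k T), flip J k (flip J k T) = T,
      forall J' v, v < n -> J' <= J -> tab_cnt (flip J k T) J' v = tab_cnt T J' v &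
      forall d, tab_cnt T J k = tab_cnt T J k.+1 + d ->
      [/\ tab_wt (flip J k T) k = tab_wt T k.+1 + d,
          tab_wt (flip J k T) k.+1 + d = tab_wt T k &
          forall v, v < n -> v != k -> v != k.+1 -> tab_wt (flip J k T) v = tab_wt T v]].
Proof.
move=> sT kn HJ; have Hp := tab_pat_gt Hs sT; have cT := tab_patP Hs sT.
have Hp' := toggle_pattern Hp kn HJ.
have kn' : k < n by lia.
have cf : compat (flip J k T) (toggle J k (tab_pat T)).
  rewrite /flip; case: pickP => [//|no].
  by have [T' cT'] := compat_ex Hs Hp'; move: (no T'); rewrite cT'.
have pf := compat_pat Hs Hp' cf.
split.
- exact: (compat_ssyt _ Hp' cf).
- have c2 : compat T (toggle J k (tab_pat (flip J k T))).
    apply/compatP => b k' kn2; rewrite (toggle_ext _ kn pf) //.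
    by rewrite (toggleK Hp kn HJ); move/compatP: cT; apply.
  rewrite {1}/flip; case: pickP => [T' cT'|no] /=; first exact: (compat_uniq cT' c2).
  by move: (no T); rewrite c2.
- move=> J' v vn JJ'; rewrite (tab_cntE Hs _ Hp' cf) // (tab_cntE Hs _ Hp cT) //.
  exact: (toggle_cnt Hp).
- move=> d; rewrite !(tab_cntE Hs _ Hp cT) // => cd.
  rewrite !(tab_wtE Hs Hp' cf) // !(tab_wtE Hs Hp cT) //.
  have [w1 w2 w3] := toggle_wt Hp la_out kn HJ cd.
  split=> // v vn n1 n2; rewrite (tab_wtE Hs Hp' cf) // (tab_wtE Hs Hp cT) //.
  exact: w3.
Qed.

Lemma tab_cnt0 T v : tab_cnt T 0 v = 0.
Proof. by apply: eq_card0 => b; rewrite inE. Qed.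

Lemma skew_schur_sym : skew_schur n la mu \is symmetric.
Proof.
apply: sym_adjacent => i j ij; rewrite skew_schurE raddf_sum /=.
have kn : i.+1 < n by have := ltn_ord j; lia.
(* At [J = 0] the flip is the classical Bender-Knuth involution, defined on all tableaux. *)
have HJ T : forall r, 0 <= tab_pat T i.+2 r -> 0 <= tab_pat T i.+1 r by [].
rewrite [RHS](reindex_onto (flip 0 i) (flip 0 i)) /=; last first.
  by move=> T sT; case: (flipP sT kn (HJ T)).
apply: eq_big => [T|T sT].
  apply/idP/andP => [sT|[sT /eqP e]].
    by case: (flipP sT kn (HJ T)) => -> ->.
  by rewrite -e; case: (flipP sT kn (HJ _)).
case: (flipP sT kn (HJ T)) => _ _ _ /(_ 0); rewrite !tab_cnt0 => /(_ erefl).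
rewrite !addn0 => -[w1 w2 w3].
rewrite msymX tpermV; congr mpolyX; apply/mnmP => v; rewrite !mnmE.
case: tpermP => [->|->|/eqP n1 /eqP n2].
- by rewrite ij w1.
- by rewrite ij w2.
- by rewrite w3 //; rewrite -ij.
Qed.

Definition bad_at T J v := (v.+1 < n) && (tab_cnt T J v.+1 < tab_cnt T J v).
Definition bad_col T J := [exists v : 'I_n, bad_at T J v].
(* The columns are read from left to right, so contents of lattice tableaux are
   nondecreasing in the value; accordingly [mrho] is increasing and a partition
   enters the exponents in reverse order, see [pmon]. *)
Definition good T := [forall J : 'I_(head 0 la).+1, ~~ bad_col T J].

Lemma goodP T : reflect
  (forall J v, v.+1 < n -> tab_cnt T J v <= tab_cnt T J v.+1) (good T).
Proof.
apply: (iffP forallP) => h.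
  move=> J v vn; wlog JM : J / J <= head 0 la => [hw|].
    case: (leqP J (head 0 la)) => JM; first exact: hw.
    have e w : tab_cnt T J w = tab_cnt T (head 0 la) w.
      apply: eq_card => b; rewrite !inE; case/andP: (cellP b) => _ lt.
      by have lt2 := leq_trans lt (la_head Hs _); rewrite lt2 (ltn_trans lt2 JM).
    by rewrite !e; apply: hw.
  have /existsPn /(_ (Ordinal (ltnW vn))) := h (Ordinal (JM : J < (head 0 la).+1)).
  by rewrite /bad_at vn /= -leqNgt.
move=> J; apply/existsPn => v; rewrite /bad_at; case: ltnP => //= vn.
by rewrite -leqNgt; apply: h.
Qed.

Definition first_col T := find (bad_col T) (iota 0 (head 0 la).+1).
Definition first_val T := find (bad_at T (first_col T)) (iota 0 n).
(** [first_col] is the least number of initial columns violating the lattice condition. The flip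
    changes only columns to their right, so both searches give the same result on the conjugate,
    whence an involution. *)
Definition bad_conj T := flip (first_col T) (first_val T) T.

Lemma bad_conjP T : is_ssyt T -> ~~ good T ->
  [/\ is_ssyt (bad_conj T), ~~ good (bad_conj T), bad_conj (bad_conj T) = T &
      alt (mwt (bad_conj T) + mrho n)%MM = (- alt (mwt T + mrho n)%MM)%R].
Proof.
move=> sT bT.
have [J JM [bJ minJ]] : exists2 J, J < (head 0 la).+1 &
    bad_col T J /\ forall J', J' < J -> ~~ bad_col T J'.
  case: (@ex_minnP (fun J => (J < (head 0 la).+1) && bad_col T J)).
    by case/forallPn: bT => J; rewrite negbK => h; exists J; rewrite ltn_ord.
  move=> J /andP[h1 h2] min; exists J => //; split=> // J' lt.
  by apply/negP => h; have := min J'; rewrite h andbT; lia.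
have [v vn [bv minv]] : exists2 v, v < n &
    bad_at T J v /\ forall v', v' < v -> ~~ bad_at T J v'.
  case: (@ex_minnP (fun v => (v < n) && bad_at T J v)).
    by case/existsP: bJ => w h; exists w; rewrite ltn_ord.
  move=> v /andP[h1 h2] min; exists v => //; split=> // v' lt.
  by apply/negP => h; have := min v'; rewrite h andbT; lia.
have fJ : first_col T = J by apply: find_iota.
have fv : first_val T = v by rewrite /first_val fJ; apply: find_iota.
case/andP: (bv) => vn1 ltv.
have Hp := tab_pat_gt Hs sT; have cT := tab_patP Hs sT.
(* Zero columns violate nothing, so there is a last column [J] before which the lattice condition
   still holds. *)
case: J => [|J] in JM bJ minJ bv minv fJ ltv *; first by rewrite !tab_cnt0 in ltv.
have leJ : tab_cnt T J v <= tab_cnt T J v.+1.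
  have /existsPn /(_ (Ordinal vn)) := minJ J (ltnSn J).
  by rewrite /bad_at vn1 /= -leqNgt.
have [e HJ] : tab_cnt T J.+1 v = (tab_cnt T J.+1 v.+1).+1 /\
    (forall r, J.+1 <= tab_pat T v.+2 r -> J.+1 <= tab_pat T v.+1 r).
  rewrite !(tab_cntE Hs _ Hp cT) // in ltv leJ *.
  exact: (pat_first_bad Hp la_out).
have [sF FF cF wF] := flipP sT vn1 HJ.
have FE : bad_conj T = flip J.+1 v T by rewrite /bad_conj fJ fv.
have bE J' w : J' <= J.+1 -> bad_at (flip J.+1 v T) J' w = bad_at T J' w.
  move=> JJ; rewrite /bad_at; case: ltnP => //= wn; rewrite !cF //; lia.
have cE J' : J' <= J.+1 -> bad_col (flip J.+1 v T) J' = bad_col T J'.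
  by move=> JJ; apply: eq_existsb => w; rewrite bE.
have fJ' : first_col (flip J.+1 v T) = J.+1.
  by apply: find_iota => // [|J' lt]; rewrite cE // ?minJ // ltnW.
have fv' : first_val (flip J.+1 v T) = v.
  by rewrite /first_val fJ'; apply: find_iota => // [|w lt]; rewrite bE // minv.
rewrite FE; split=> //.
- by apply/forallPn; exists (Ordinal JM); rewrite negbK /= cE.
- by rewrite /bad_conj fJ' fv'.
have [w1 w2 w3] := wF 1 (etrans e (esym (addn1 _))).
pose i := Ordinal vn; pose j := Ordinal vn1.
(* The surplus of [v] is exactly 1, the difference of neighbouring entries of [mrho]: after adding
   [mrho] the two exponents are exchanged. *)
have -> : (mwt (flip J.+1 v T) + mrho n)%MM =
   [multinom (mwt T + mrho n)%MM (tperm i j k) | k < n].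
  apply/mnmP => k; rewrite mnmE !mnmDE !mnmE.
  case: tpermP => [->|->|/eqP n1 /eqP n2] /=; [lia|lia|].
  by rewrite w3 // -val_eqE.
rewrite alt_perm odd_tperm.
have -> : i != j by rewrite -val_eqE /=; lia.
by rewrite expr1 scaleN1r.
Qed.

Theorem stembridge :
  (alt (mrho n) * skew_schur n la mu =
   \sum_(T | is_ssyt T && good T) alt (mwt T + mrho n)%MM)%R.
Proof.
rewrite alt_mul_sym ?skew_schur_sym // skew_schurE.
transitivity (\sum_(T | is_ssyt T) alt (mwt T + mrho n)%MM)%R.
  rewrite /alt [RHS]exchange_big /=; apply: eq_bigr => s _.
  rewrite mulr_sumr [msym s _]raddf_sum /= scaler_sumr.
  by apply: eq_bigr => T _; rewrite -mpolyXD addmC.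
rewrite (bigID good) /= [X in (_ + X)%R](_ : _ = 0)%R ?addr0 //.
apply: (@sum_sign_involution _ _ _ bad_conj).
- exact: mpoly_int_tf.
- by move=> T /andP[sT bT]; case: (bad_conjP sT bT) => -> ->.
- by move=> T /andP[sT bT]; case: (bad_conjP sT bT).
Qed.

End Stembridge.

(** * Schur functions of partitions as quotients of alternants *)

Definition pmon n (nu : seq nat) : 'X_{1..n} := [multinom nth 0 nu (n - i.+1) | i < n].

Lemma pmon_inj n nu nu' : is_part nu -> is_part nu' -> size nu <= n -> size nu' <= n ->
  pmon n nu = pmon n nu' -> nu = nu'.
Proof.
move=> p p' s s' /mnmP e; apply: is_part_eq => // i.
case: (ltnP i n) => h; last by rewrite !nth_default //; lia.
have lt : n - i.+1 < n by lia.
have := e (Ordinal lt); rewrite !mnmE /=.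
by have -> : n - (n - i.+1).+1 = i by lia.
Qed.

Lemma pmon_inc n nu : is_part nu -> forall i j : 'I_n, i < j ->
  (pmon n nu + mrho n)%MM i < (pmon n nu + mrho n)%MM j.
Proof.
move=> p; apply: (mrho_inc (f := fun i => nth 0 nu (n - i.+1))) => i j ij jn.
apply: (noninc_leq (f := nth 0 nu)); last lia.
by move=> k; apply: is_part_noninc.
Qed.

Lemma straight_shape nu : is_part nu -> skew_shape nu [::].
Proof. by move=> p; split => // r; rewrite nth_nil. Qed.

(** Interlacing from the empty shape gives [p k k = 0] for all [k], so level [n] has at most [n]
    rows. *)
Lemma schur_small n nu : is_part nu -> n < size nu -> schur n nu = 0%R.
Proof.
move=> pn ns; rewrite /schur skew_schurE big_pred0 // => T; apply/negP => sT.
have Hp := tab_pat_gt (straight_shape pn) sT.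
have : forall k, k <= n -> tab_pat T k k = 0.
  elim=> [|k IH] kn; first by rewrite (gt_bot Hp) nth_nil.
  by have := gt_il Hp k kn; rewrite IH; lia.
by move=> /(_ n (leqnn n)); rewrite (gt_top Hp); have := is_part_gt0 pn ns; lia.
Qed.

(** The bialternant formula: for a straight shape the sum of [stembridge] has a single term, since
    the lattice pattern is forced. *)
Lemma schur_alt n nu : is_part nu -> size nu <= n ->
  (alt (mrho n) * schur n nu)%R = alt (pmon n nu + mrho n)%MM.
Proof.
move=> pn sn; have ss := straight_shape pn; rewrite /schur stembridge //.
have noninc j : nth 0 nu j.+1 <= nth 0 nu j by apply: is_part_noninc.
have out r : size nu <= r -> nth 0 nu r = 0 by exact: nth_default.
have [[b0 t0 l0 i0] g0] := straight_pattern_good noninc out (out n sn).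
have Hp0 : gt_pattern n (nth 0 [::]) (nth 0 nu) (fun k r => nth 0 nu (r + (n - k))).
  by split => // r; rewrite b0 nth_nil.
have [T0 cT0] := compat_ex ss Hp0.
have wE T p : gt_pattern n (nth 0 [::]) (nth 0 nu) p -> compat T p ->
    (forall J v, v.+1 < n -> pat_cnt (size nu) p J v <= pat_cnt (size nu) p J v.+1) ->
    mwt T = pmon n nu /\ T = T0.
  move=> Hp cT gT.
  have Hp' : gt_pattern n (fun _ => 0) (nth 0 nu) p.
    by case: Hp => b t l i; split => // r; rewrite b nth_nil.
  split.
    by apply/mnmP => i; rewrite !mnmE (tab_wtE ss Hp cT) // (straight_wt Hp' out).
  apply: (compat_uniq cT); apply/compatP => b k kn.
  by rewrite (straight_pattern Hp' out) //; move/compatP: cT0 => ->.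
have sT0 := compat_ssyt ss Hp0 cT0.
have gT0 : good T0.
  by apply/(goodP ss) => J v vn; rewrite !(tab_cntE ss _ Hp0 cT0) //; [exact: g0 | lia].
rewrite (big_pred1 T0); first by have [-> _] := wE _ _ Hp0 cT0 g0.
move=> T; apply/andP/eqP => [[sT /(goodP ss) gT]|->//].
have Hp := tab_pat_gt ss sT; have cT := tab_patP ss sT.
case: (wE _ _ Hp cT) => // J v vn.
by have := gT J v vn; rewrite !(tab_cntE ss _ Hp cT) //; lia.
Qed.

(** * The Schur support in terms of lattice tableaux *)

Section Support.
Variables (la mu : seq nat).
Hypothesis Hs : skew_shape la mu.

Definition lr_set n nu := [pred T : {ffun cell la mu -> 'I_n} |
  [&& is_ssyt T, good T & mwt T == pmon n nu]].

Definition tab_part n (T : {ffun cell la mu -> 'I_n}) :=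
  [seq x <- rev (mkseq (tab_wt T) n) | x != 0].

Lemma good_wt n (T : {ffun cell la mu -> 'I_n}) v : good T -> v.+1 < n ->
  tab_wt T v <= tab_wt T v.+1.
Proof. by move=> /(goodP Hs) g vn; rewrite -!(tab_cnt_big Hs); apply: g. Qed.

Lemma good_sorted n (T : {ffun cell la mu -> 'I_n}) : good T ->
  sorted geq (rev (mkseq (tab_wt T) n)).
Proof.
move=> g; rewrite rev_sorted.
apply: (@sub_sorted _ leq) => //.
apply: (path_sorted (x := 0)).
apply/(pathP 0) => i; rewrite size_mkseq => iN.
case: i iN => [//|i] iN /=; rewrite !nth_mkseq //; last by lia.
exact: good_wt.
Qed.

Lemma tab_part_is_part n (T : {ffun cell la mu -> 'I_n}) : good T -> is_part (tab_part T).
Proof. by move=> g; apply/is_part_filter/good_sorted. Qed.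

Lemma tab_part_size n (T : {ffun cell la mu -> 'I_n}) : size (tab_part T) <= n.
Proof. by rewrite size_filter (leq_trans (count_size _ _)) // size_rev size_mkseq. Qed.

Lemma tab_part_mwt n (T : {ffun cell la mu -> 'I_n}) : good T -> pmon n (tab_part T) = mwt T.
Proof.
move=> g; apply/mnmP => i; rewrite !mnmE nth_filter_nz ?good_sorted //.
have iN := ltn_ord i.
rewrite nth_rev size_mkseq; last lia.
rewrite nth_mkseq; last lia.
by congr tab_wt; lia.
Qed.

Lemma tab_part_sumn n (T : {ffun cell la mu -> 'I_n}) : sumn (tab_part T) = #|cell la mu|.
Proof.
rewrite /tab_part sumn_filter_nz sumn_rev sumnE big_map.
have -> : iota 0 n = index_iota 0 n by rewrite /index_iota subn0.
rewrite big_mkord -sum1_card (partition_big T xpredT) //=.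
by apply: eq_bigr => v _; rewrite /tab_wt -sum1_card; apply: eq_bigl => b; rewrite inE -val_eqE.
Qed.

Lemma lr_setP n nu (T : {ffun cell la mu -> 'I_n}) : is_part nu -> size nu <= n ->
  (T \in lr_set n nu) = [&& is_ssyt T, good T & tab_part T == nu].
Proof.
move=> pn sn; rewrite inE; case sT: (is_ssyt T) => //=; case g: (good T) => //=.
rewrite -(tab_part_mwt g); apply/eqP/eqP => [|->//].
by apply: pmon_inj => //; [exact: tab_part_is_part | exact: tab_part_size].
Qed.

(** A lattice tableau of content [nu] uses only the [size nu] largest values, so adding [d] to all
    entries is a bijection. *)
Lemma lr_shift d nu : #|lr_set (d + size nu) nu| = #|lr_set (size nu) nu|.
Proof.
set m := size nu.
pose h (T : {ffun cell la mu -> 'I_m}) : {ffun cell la mu -> 'I_(d + m)} :=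
  [ffun b => rshift d (T b)].
have hinj : injective h.
  move=> T T' /ffunP e; apply/ffunP => b; have := e b; rewrite !ffunE.
  exact: rshift_inj.
rewrite -(card_imset _ hinj); apply: eq_card => T'.
have cntE (T : {ffun cell la mu -> 'I_m}) J v : tab_cnt (h T) J (d + v) = tab_cnt T J v.
  by apply: eq_card => b; rewrite !inE ffunE /= eqn_add2l.
have cnt0 (T : {ffun cell la mu -> 'I_m}) J v : v < d -> tab_cnt (h T) J v = 0.
  move=> vd; apply: eq_card0 => b; rewrite !inE ffunE /=.
  by rewrite (_ : _ == v = false) ?andbF //; lia.
have sE (T : {ffun cell la mu -> 'I_m}) : is_ssyt (h T) = is_ssyt T.
  apply: eq_forallb => a; apply: eq_forallb => b; rewrite !ffunE /=.
  by rewrite leq_add2l ltn_add2l.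
have gE (T : {ffun cell la mu -> 'I_m}) : good (h T) = good T.
  apply/(goodP Hs)/(goodP Hs) => g J v vn.
    by have := g J (d + v); rewrite -addnS !cntE; apply; lia.
  case: (ltnP v d) => vd; first by rewrite cnt0.
  have -> : v = d + (v - d) by lia.
  by rewrite -addnS !cntE; apply: g; lia.
have wE (T : {ffun cell la mu -> 'I_m}) :
    (mwt (h T) == pmon (d + m) nu) = (mwt T == pmon m nu).
  apply/eqP/eqP => /mnmP e; apply/mnmP => v.
    have := e (rshift d v); rewrite !mnmE /= -!(tab_cnt_big Hs) cntE.
    by rewrite -addnS subnDl.
  rewrite !mnmE -(tab_cnt_big Hs); case: (split_ordP v) => j -> /=.
    by rewrite cnt0 ?ltn_ord // nth_default //; have := ltn_ord j; rewrite -/m; lia.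
  have := e j; rewrite !mnmE -(tab_cnt_big Hs) cntE => ->.
  by rewrite -addnS subnDl.
apply/idP/imsetP => [|[T TL ->]]; last by move: TL; rewrite !inE sE gE wE.
move=> TL; have := TL; rewrite inE => /and3P[sT gT /eqP wT].
have /fin_all_exists [f hf] : forall b, exists j : 'I_m, T' b = rshift d j.
  move=> b; case: (split_ordP (T' b)) => j e; last by exists j.
  have /mnmP /(_ (T' b)) := wT; rewrite !mnmE.
  rewrite [RHS]nth_default; last by rewrite e /=; have := ltn_ord j; rewrite -/m; lia.
  by move/card0_eq => /(_ b); rewrite inE eqxx.
have eT : T' = h (finfun f) by apply/ffunP => b; rewrite !ffunE hf.
by exists (finfun f) => //; move: TL; rewrite eT !inE sE gE wE.
Qed.

Lemma lr_shiftE n nu : size nu <= n -> #|lr_set n nu| = #|lr_set (size nu) nu|.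
Proof. by move=> h; rewrite -(lr_shift (n - size nu)) subnK. Qed.

Lemma skew_schur_good n : (skew_schur n la mu =
  \sum_(T : {ffun cell la mu -> 'I_n} | is_ssyt T && good T) schur n (tab_part T))%R.
Proof.
apply: (mulfI (alt_rho_neq0 n)); rewrite stembridge // mulr_sumr.
apply: eq_bigr => T /andP[sT gT].
by rewrite schur_alt ?tab_part_size ?tab_part_is_part // tab_part_mwt.
Qed.

(** In [size nu] variables the coefficient at [pmon n nu + mrho n] isolates [c nu]: longer
    partitions contribute zero and the others have different exponents. Without a lattice tableau of
    content [nu] this coefficient vanishes. *)
Lemma support_lr nu : schur_support la mu nu ->
  is_part nu /\ exists T, T \in lr_set (size nu) nu.
Proof.
case=> s [c [[us /allP ps ex] nus c0]]; have pn := ps _ nus; split => //.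
set n := size nu.
have := congr1 (fun q => (alt (mrho n) * q)%R) (ex n).
rewrite /= stembridge // mulr_sumr => /(congr1 (mcoeff (pmon n nu + mrho n)%MM)).
rewrite !raddf_sum /=.
rewrite [RHS](bigD1_seq nu) //= -scalerAr mcoeffZ schur_alt // mcoeff_alt; try exact: pmon_inc.
rewrite eqxx mulr1 [X in (_ + X)%R]big_seq_cond [X in (_ + X)%R]big1 ?addr0; last first.
  move=> k /andP[ks nk]; rewrite -scalerAr mcoeffZ.
  case: (leqP (size k) n) => sk; last by rewrite schur_small ?ps // mulr0 mcoeff0 mulr0.
  rewrite schur_alt ?ps // mcoeff_alt; try by apply: pmon_inc; rewrite ?ps.
  case: eqP => [/addIm e|]; last by rewrite mulr0.
  by case/negP: nk; apply/eqP; apply: pmon_inj e => //; exact: ps.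
move=> e; case: (pickP (mem (lr_set n nu))) => [T TL|no]; first by exists T.
suff e0 : c nu = 0%R by rewrite e0 Order.POrderTheory.ltxx in c0.
rewrite -e big1 // => T /andP[sT gT].
have mE := tab_part_mwt gT; rewrite -mE mcoeff_alt; try exact: pmon_inc; last first.
  by apply: pmon_inc; exact: tab_part_is_part.
by case: eqP => // /addIm e'; move: (no T); rewrite /= inE sT gT /= -mE e' eqxx.
Qed.

(** The expansion is indexed by the contents of lattice tableaux in as many variables as there are
    cells. A content has at most that many parts, so by [lr_shiftE] no further one appears in any
    number of variables. *)
Lemma lr_support nu : is_part nu -> (exists T, T \in lr_set (size nu) nu) ->
  schur_support la mu nu.
Proof.
move=> pn [T0 T0L]; pose N := #|cell la mu|.
pose s := undup (image (@tab_part N) [pred T | is_ssyt T && good T]).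
pose c k : int := (#|lr_set (size k) k|)%:R%R.
have ins n (T : {ffun cell la mu -> 'I_n}) : is_ssyt T -> good T -> tab_part T \in s.
  move=> sT gT; have pT := tab_part_is_part gT.
  have sz : size (tab_part T) <= N.
    by rewrite /N -(tab_part_sumn T); apply: size_le_sumn; case/andP: pT.
  have : 0 < #|lr_set N (tab_part T)|.
    rewrite lr_shiftE // -(@lr_shiftE n) ?tab_part_size //.
    by apply/card_gt0P; exists T; rewrite lr_setP ?tab_part_size // sT gT /=.
  case/card_gt0P => T'; rewrite lr_setP // => /and3P[sT' gT' /eqP eT'].
  rewrite mem_undup -eT'; apply/imageP; exists T' => //.
  by rewrite inE sT' gT'.
have ps : all is_part s.
  apply/allP => k; rewrite mem_undup => /imageP[T]; rewrite inE => /andP[_ gT] ->.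
  exact: tab_part_is_part.
exists s, c; split; [split => // [|n] | | ].
- exact: undup_uniq.
- rewrite skew_schur_good.
  rewrite (eq_bigr (fun T => \sum_(k <- s | tab_part T == k) schur n k)%R); last first.
    move=> T /andP[sT gT]; rewrite big_mkcond (bigD1_seq (tab_part T)) ?undup_uniq ?ins //=.
    by rewrite eqxx big1 ?addr0 // => k; rewrite eq_sym => /negbTE ->.
  rewrite (exchange_big_dep xpredT) //=.
  rewrite big_seq [RHS]big_seq; apply: eq_bigr => k ks; have pk := allP ps k ks.
  case: (leqP (size k) n) => sk; last by rewrite schur_small // scaler0 big1.
  rewrite /c -(lr_shiftE sk) scaler_nat -sumr_const.
  by apply: eq_bigl => T; rewrite lr_setP // andbA.
- move: T0L; rewrite lr_setP // => /and3P[sT gT /eqP <-]; exact: ins.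
- by rewrite /c ltr0n; apply/card_gt0P; exists T0.
Qed.

End Support.

(** * Chains of horizontal strips *)

Fixpoint ps (f : nat -> nat) (k : nat) : nat := if k is k'.+1 then ps f k' + f k' else 0.

Lemma psS f k : ps f k.+1 = ps f k + f k. Proof. by []. Qed.

Lemma ps_leq f g k : (forall i, i < k -> f i <= g i) -> ps f k <= ps g k.
Proof.
elim: k => [//|k IH] h /=; have := h k (ltnSn k).
by have := IH (fun i lt => h i (ltnW lt)); lia.
Qed.

Lemma ps_mono f j k : j <= k -> ps f j <= ps f k.
Proof.
elim: k => [|k IH] jk; first by have -> : j = 0 by lia.
by case: (eqVneq j k.+1) => [->//|ne]; have := IH; rewrite /=; lia.
Qed.

Lemma ps_ge f c j k : j <= k -> (forall i, j <= i -> i < k -> c <= f i) ->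
  ps f j + c * (k - j) <= ps f k.
Proof.
elim: k => [|k IH] jk h; first by have -> : j = 0; lia.
case: (eqVneq j k.+1) => [->|ne]; first lia.
have jk' : j <= k by lia.
have := IH jk' (fun i ji ik => h i ji (ltnW ik)); have := h k jk' (ltnSn k).
rewrite /= (subSn jk') mulnS; lia.
Qed.

Lemma ps_le_const f c k : (forall i, i < k -> f i <= c) -> ps f k <= c * k.
Proof.
elim: k => [|k IH] h /=; first lia.
have := h k (ltnSn k); have := IH (fun i lt => h i (ltnW lt)); rewrite mulnS; lia.
Qed.

Lemma ps_zero f j k : j <= k -> (forall i, j <= i -> i < k -> f i = 0) -> ps f k = ps f j.
Proof.
elim: k => [|k IH] jk h; first by have -> : j = 0 by lia.
case: (eqVneq j k.+1) => [->//|ne] /=.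
have jk' : j <= k by lia.
by rewrite (h k jk' (ltnSn k)) (IH jk' (fun i ji ik => h i ji (ltnW ik))) addn0.
Qed.

Lemma ps_eq f g k : (forall i, i < k -> f i = g i) -> ps f k = ps g k.
Proof. by elim: k => [//|k IH] h /=; rewrite h // IH // => i /ltnW /h. Qed.

Lemma psD f g k : ps (fun i => f i + g i) k = ps f k + ps g k.
Proof. by elim: k => [//|k IH] /=; rewrite IH; lia. Qed.

Lemma ps_delta i x k : i < k -> ps (fun j => (j == i) * x) k = x.
Proof.
elim: k => [//|k IH] ik /=; case: (eqVneq k i) => [e|ne].
  rewrite (@ps_zero _ 0) //= => [|j _ jk]; first lia.
  by have -> : (j == i) = false by lia.
by rewrite IH; lia.
Qed.

Lemma ps_shift f k : ps (fun i => f i.+1) k + f 0 = ps f k.+1.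
Proof. by elim: k => [//|k IH]; rewrite psS -addnA [f k.+1 + _]addnC addnA IH. Qed.

(** Filling from the top: [w] equals the upper bound before the pivot [t] and the lower bound after
    it, which makes its partial sums as large as possible. *)
Lemma greedy_fill f u m A : (forall i, f i <= u i) -> ps f m <= A -> A <= ps u m ->
  exists w t, [/\ forall j, j < t -> w j = u j, forall j, t < j -> w j = f j,
    forall j, f j <= w j <= u j, forall j, m <= j -> w j = f j & ps w m = A].
Proof.
move=> fu; elim: m A => [|m IH] A /=.
  move=> _ A0; exists f, 0; split=> //; last by case: A A0.
  by move=> j; rewrite leqnn fu.
move=> l1 l2; case: (leqP A (ps u m + f m)) => h.
  case: (IH (A - f m)); [lia|lia|] => w [t [w1 w2 w3 w4 w5]].
  by exists w, t; split=> // [j jm|]; [apply: w4; lia | rewrite w4 // w5; lia].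
exists (fun j => if j < m then u j else if j == m then A - ps u m else f j), m; split.
- by move=> j ->.
- by move=> j mj; case: ltnP; last case: eqP; lia.
- move=> j; have := fu j; case: ltnP => jm; first by move=> ->; rewrite leqnn.
  by case: eqP => [->|_]; [have := fu m; lia | move=> ->; rewrite leqnn].
- by move=> j mj; case: ltnP; last case: eqP; lia.
- rewrite ltnn eqxx (@ps_eq _ u); first lia.
  by move=> i ->.
Qed.

(* One step of the construction of a chain: [a], [S], [o] and [B] give the row
   lengths, and for the rows [>= i] the number of boxes, of overlaps and of
   columns; [e0] tells whether the first two rows overlap. *)
Section Step.
Variables (m : nat) (a S o B nu : nat -> nat) (e0 : bool).
Hypothesis m2 : 2 <= m.
Hypothesis aS : forall i, S i = a i + S i.+1.
Hypothesis a2 : forall i, i < m -> 2 <= a i.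
Hypothesis S0 : forall i, m <= i -> S i = 0.
Hypothesis amono : forall i, a i.+1 <= a i.
Hypothesis o1 : forall i, o i.+1 <= o i.
Hypothesis o2 : forall i, o i <= (o i.+1).+1.
Hypothesis o0 : forall i, m <= i.+1 -> o i = 0.
Hypothesis oe : o 0 = e0 + o 1.
Hypothesis BE : forall i, B i = S i - o i.
Hypothesis numono : forall i, nu i.+1 <= nu i.
Hypothesis nuB : forall i, nu i <= B i.
Hypothesis nutot : ps nu m = S 0.
Hypothesis nudom : forall k, ps a k <= ps nu k.

Let a_le i j : i <= j -> a j <= a i.
Proof. exact: noninc_leq. Qed.
Let nu_le i j : i <= j -> nu j <= nu i.
Proof. exact: noninc_leq. Qed.

Let o_bound i : i < m -> o i + i.+1 <= m.
Proof.
move=> im; have [d] : exists d, m = i.+1 + d by exists (m - i.+1); lia.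
elim: d i {im} => [|d IH] i md; first by rewrite o0; lia.
have := IH i.+1; have := o2 i; lia.
Qed.

Let S_bound i : i <= m -> 2 * m <= S i + 2 * i.
Proof.
move=> im; have [d] : exists d, m = i + d by exists (m - i); lia.
elim: d i {im} => [|d IH] i md; first by rewrite S0; lia.
have := IH i.+1; have := aS i; have := @a2 i; lia.
Qed.

(** From [2 * (m - i)] boxes at least and [m - i - 1] overlaps at most. *)
Let B_bound i : i < m -> m.+1 <= B i + i.
Proof. by move=> im; rewrite BE; have := o_bound im; have := S_bound (ltnW im); lia. Qed.

Let B_zero i : m <= i -> B i = 0.
Proof. by move=> mi; rewrite BE S0. Qed.

Let B_step i : i < m -> B i + (o i - o i.+1) = a i + B i.+1.
Proof.
move=> im; rewrite !BE; have := o_bound im; have := S_bound (ltnW im).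
have := aS i; have := o1 i; have := S_bound im.
case: (ltnP i.+1 m) => h; first by have := o_bound h; lia.
by rewrite (o0 (i := i)) ?(o0 (i := i.+1)); lia.
Qed.

Let B_lt i : i < m -> B i.+1 < B i.
Proof. by move=> im; have := B_step im; have := @a2 i im; have := o2 i; lia. Qed.

Let B_le i j : i <= j -> B j <= B i.
Proof.
elim: j => [|j IH] ij; first by have -> : i = 0 by lia.
case: (eqVneq i j.+1) => [->//|ne]; have := IH.
by case: (ltnP j m) => h; [have := B_lt h; lia | rewrite (B_zero (i := j.+1)); lia].
Qed.

Let nu_zero i : m <= i -> nu i = 0.
Proof. by move=> mi; have := nuB i; rewrite B_zero; lia. Qed.

Let aps k : ps a k + S k = S 0.
Proof. by elim: k => [//|k IH] /=; have := aS k; lia. Qed.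

Let nu0 : a 0 <= nu 0. Proof. by have := nudom 1; rewrite /=; lia. Qed.
Let a0 : 2 <= a 0. Proof. by apply: a2; lia. Qed.

Variable r : nat.
Hypothesis r1 : nu r = nu 0.
Hypothesis r2 : nu r.+1 < nu 0.

Let rm : r < m.
Proof. by rewrite ltnNge; apply/negP => /nu_zero; lia. Qed.

(* Upper bounds for the remaining shape.  Row [r] is the highest row that a
   horizontal strip of [nu] can meet, and the term [j == r] forces it to do so:
   hence the condition for the next strip to lie below is as weak as possible. *)
Let u j := minn (B j.+1) (nu j - (j == r)).

(** The extra 1 pays for the box that [u] takes from row [r]. If it were missing,
    [a 0 <= nu k < nu 0], and the first rows of [nu] would be too long. *)
Let strict_dom k : nu k < nu 0 -> (ps a k.+1).+1 <= ps nu k + a 0.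
Proof.
move=> lt; rewrite ltnNge; apply/negP => le.
have := nudom k.+1; rewrite (psS nu) => d.
case: k lt le d => [|k] lt le d; first by rewrite ltnn in lt.
have h0 : a 0 < nu 0 by lia.
have := @ps_ge nu (a 0) 1 k.+1 isT.
have hk i : 1 <= i -> i < k.+1 -> a 0 <= nu i by move=> _ ik; have := @nu_le i k.+1; lia.
move=> /(_ hk).
have := @ps_le_const a (a 0) k.+2 (fun i _ => a_le (leq0n i)).
rewrite [ps nu 1]/= !mulnS subSS subn0; lia.
Qed.

Let ps_u_pre i : (forall j, j < i -> nu j <= B j.+1) -> ps u i + (r < i) = ps nu i.
Proof.
elim: i => [//|i IH] h /=; have := IH (fun j lt => h j (ltnW lt)).
have := h i (ltnSn i); rewrite /u.
case: (eqVneq i r) => [->|ne] hh; first by rewrite ltnn ltnSn; lia.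
have -> : (r < i.+1) = (r < i) by lia.
lia.
Qed.

Let pre i : (forall j, j < i -> nu j <= B j.+1) -> ps a i.+1 <= ps u i + a 0.
Proof.
move=> h; have := ps_u_pre h; case: (ltnP r i) => ri.
  by have := @nu_le r.+1 i ri; have := @strict_dom i; lia.
by have := nudom i; rewrite psS; have := a_le (leq0n i); lia.
Qed.

Let u_cap i : B i.+1 < nu i -> u i = B i.+1.
Proof. by rewrite /u; case: (i == r); lia. Qed.

Let first_cap k : (forall j, j < k -> nu j <= B j.+1) \/
  exists i, [/\ i < k, B i.+1 < nu i & forall j, j < i -> nu j <= B j.+1].
Proof.
case: (boolP [exists i : 'I_k, B i.+1 < nu i]) => [/existsP[i0 hi0]|/existsPn h]; last first.
  by left=> j jk; rewrite leqNgt; exact: (h (Ordinal jk)).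
right; case: (@ex_minnP (fun i => (i < k) && (B i.+1 < nu i))).
  by exists i0; rewrite ltn_ord.
move=> i /andP[ik hi] min; exists i; split=> // j ji.
by rewrite leqNgt; apply/negP => h; have := min j; rewrite h andbT; lia.
Qed.

(** Up to the first row [i] cut by its cap [B i.+1], dominance comes from [nu]. That row contributes
    all columns of the ribbon rows [> i], and the missing [o i.+1] boxes are supplied by at least
    one box in each later row together with [S k.+1]. *)
Let dom_u k : k < m -> (forall j, j < k -> 0 < nu j) -> ps a k.+1 <= ps u k + a 0.
Proof.
move=> km nz; case: (first_cap k) => [h|[i [ik ci h]]]; first exact: pre.
have p1 := pre h; have uc := u_cap ci.
have h1 j : i.+1 <= j -> j < k -> 1 <= u j.
  move=> ij jk; rewrite /u; have := nz j jk.
  have jm : j.+1 < m by lia.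
  have := B_bound jm; case: (eqVneq j r) => [e|_]; last lia.
  have im : i.+1 < m by lia.
  by have := B_bound im; have := nu_le (leq0n i); rewrite e r1; lia.
have := ps_ge ik h1; rewrite mul1n psS uc BE.
have im : i.+1 < m by lia.
have := o_bound im; have := S_bound km; have := aps k.+1; have := aps i.+1.
lia.
Qed.

(** Since [ps nu m = a 0 + S 1], the bound [u] may lose at most [a 0] boxes against [nu]. If [nu]
    has at least [m - 1] rows, [dom_u] suffices; otherwise the rows cut by a cap are examined. *)
Let tot_u : S 1 <= ps u m.
Proof.
have e0S := aS 0.
case: (posnP (nu (m - 2))) => [z|nz]; last first.
  have h := @dom_u m.-1; have := aps m.-1.+1.
  rewrite (S0 (i := m.-1.+1)); last lia.
  have := @ps_mono u m.-1 m (leq_pred m).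
  suff : ps a m.-1.+1 <= ps u m.-1 + a 0 by lia.
  by apply: h; [lia|] => j jm; have := @nu_le j (m - 2); lia.
case: (first_cap m) => [h|[i [im ci h]]].
  by have := pre h; have := aps m.+1; rewrite (S0 (i := m.+1)) ?leqnSn //; lia.
have p1 := pre h; have uc := u_cap ci.
have im2 : i.+2 < m by rewrite ltnNge; apply/negP => le; have := @nu_le (m - 2) i; lia.
have im1 : i.+1 < m by lia.
have ob := o_bound im1; have Sb := S_bound (ltnW im1); have ap := aps i.+1.
have BE1 := BE i.+1.
(* With a second cut row [k], each of the rows [i.+1] to [k] holds at least [B k.+1 >= m - k] boxes,
   more than enough for the at most [m - i - 2] overlaps. *)
case: (boolP [exists k : 'I_m, (i < k) && (B k.+1 < nu k)]) => [/existsP[k /andP[ik ck]]|/existsPn no].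
  have km := ltn_ord k.
  have km2 : k.+2 < m by rewrite ltnNge; apply/negP => le; have := @nu_le (m - 2) k; lia.
  have km1 : k.+1 < m by lia.
  have h1 j : i.+1 <= j -> j < k.+1 -> B k.+1 <= u j.
    move=> ij jk; rewrite /u; have := @nu_le j k; have := @B_le j.+1 k.+1.
    by case: (j == r); lia.
  have ik1 : i.+1 <= k.+1 by lia.
  have := ps_ge ik1 h1; have := ps_mono u km; rewrite (psS u i) uc.
  have := B_bound km1.
  suff : m - k <= B k.+1 -> m <= B k.+1 * (k.+1 - i.+1) + i.+1 by lia.
  have -> : k.+1 - i.+1 = (k - i - 1).+1 by lia.
  rewrite mulnS => hb.
  have : (k - i - 1) * 1 <= B k.+1 * (k - i - 1) by rewrite mulnC leq_mul2r; lia.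
  lia.
have only j : j < m -> j != i -> nu j <= B j.+1.
  move=> jm ji; case: (ltnP j i) => [/h//|ij].
  by have := no (Ordinal jm) => /=; lia.
have bi := B_step im; have ai := a_le (leq0n i); have nbi := nuB i.
(* Only row [i] is cut, which costs [nu i - B i.+1 <= a i]; for [r = i] the promised box is already
   part of this loss. *)
case: (eqVneq r i) => [ri|ri].
  have : ps nu m <= ps (fun j => u j + (j == i) * (nu i - B i.+1)) m.
    apply: ps_leq => j jm; case: (eqVneq j i) => [->|ji]; first by rewrite uc; lia.
    by rewrite /u ri (negbTE ji); have := only j jm ji; lia.
  by rewrite psD ps_delta //; lia.
have ri2 : r < i.
  rewrite ltnNge; apply/negP => ir; have := only r rm ri; rewrite r1.
  by have := nu_le (leq0n i); have := @B_le i.+1 r.+1; lia.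
have : ps nu m <= ps (fun j => u j + ((j == i) * (nu i - B i.+1) + (j == r) * 1)) m.
  apply: ps_leq => j jm; case: (eqVneq j i) => [->|ji]; first by rewrite uc; lia.
  by rewrite /u; have := only j jm ji; case: (j == r); lia.
rewrite !psD !ps_delta //.
(* Otherwise the rows up to [i] would already hold more than [S 0] boxes. *)
case: (ltnP (nu i) (B i.+1 + a 0)) => lt; first lia.
have h1 j : 1 <= j -> j < i.+1 -> nu i <= nu j by move=> _ ji; apply: nu_le.
have := @ps_ge nu (nu i) 1 i.+1 isT h1; rewrite [ps nu 1]/= subSS subn0.
have := nu_le ri2; have := @ps_mono nu i.+1 m im.
have := @ps_le_const a (a 0) i.+1 (fun j _ => a_le (leq0n j)).
have : (B i.+1 + a 0) * i <= nu i * i by rewrite leq_mul2r lt orbT.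
have : B i.+1 * 1 <= B i.+1 * i by rewrite leq_mul2l; lia.
rewrite !mulnDl !mulnS; lia.
Qed.

(** The ribbon row above relies on [w r < nu r]. A row [i] with [w i < w 0] lies below the last row
    of length [w 0], which the strip of the next ribbon row will meet in turn. *)
Lemma ribbon_step : exists w,
  [/\ forall i, nu i.+1 <= w i <= nu i,
      forall i, w i <= B i.+1,
      ps w m.-1 = S 1,
      forall k, ps (fun i => a i.+1) k <= ps w k &
      w r < nu r /\ (e0 -> exists i, w i < nu i /\ w i < w 0)].
Proof.
have e0S := aS 0.
(* The lower bound [nu j.+1] makes the removed boxes a horizontal strip. *)
pose f j := nu j.+1.
have fu j : f j <= u j.
  rewrite /f /u; have := nuB j.+1; have := numono j.
  by case: (eqVneq j r) => [->|_]; lia.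
have fm : ps f m <= S 1.
  by have := ps_shift nu m; rewrite psS (nu_zero (leqnn m)) -/f; have := nutot; lia.
have [w [t [w1 w2 w3 w4 w5]]] := greedy_fill fu fm tot_u.
have wnu i : nu i.+1 <= w i <= nu i.
  by have := w3 i; rewrite /f /u; lia.
have wB i : w i <= B i.+1 by have := w3 i; rewrite /u; lia.
have wr : w r < nu r.
  by have := w3 r; rewrite /u eqxx; have := r1; lia.
have wz j : m.-1 <= j -> w j = 0.
  by move=> mj; have := wB j; rewrite B_zero; lia.
have wtot k : m.-1 <= k -> ps w k = S 1.
  move=> mk; rewrite (ps_zero mk) => [|i mi _]; last exact: wz.
  rewrite -w5; apply/esym/ps_zero; first lia.
  by move=> i mi _; apply: wz.
exists w; split=> //.
- exact: wtot.
- move=> k; have := ps_shift a k.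
  suff : ps a k.+1 <= ps w k + a 0 by lia.
  case: (leqP m.-1 k) => mk; first by rewrite wtot //; have := aps k.+1; lia.
  case: (leqP k t) => kt.
    case: (posnP (nu k.-1)) => [z|nz]; last first.
      have -> : ps w k = ps u k by apply: ps_eq => i ik; apply: w1; lia.
      apply: dom_u; first lia.
      by move=> j jk; have := @nu_le j k.-1; lia.
    case: k => [|k] in mk kt z *; first by rewrite /= in z; lia.
    have := aps k.+2; suff -> : ps w k.+1 = S 1 by lia.
    rewrite -(wtot m); last lia.
    apply/esym/ps_zero => [|i ki _]; first lia.
    by have := wnu i; have := @nu_le k i; rewrite /= in z; lia.
  (* After the pivot [w] is [nu] shifted by one row, so counting from the end gives
     [ps w k + a 0 = ps nu k.+1]. *)
  have := nudom k.+1; have := ps_shift nu k.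
  have h j : k <= j -> ps w j + ps f k = ps w k + ps f j.
    elim: j => [|j IH] kj; first by have -> : k = 0 by lia.
    case: (eqVneq k j.+1) => [->//|ne]; rewrite !psS w2; last lia.
    by have := IH; lia.
  have := h m; rewrite w5.
  have := ps_shift nu m; rewrite psS (nu_zero (leqnn m)) -/f.
  have := nutot; lia.
- split=> // he; have oe1 : o 0 = 1 + o 1 by rewrite oe he.
  case: (boolP [exists i : 'I_m, (w i < nu i) && (w i < w 0)]) => [/existsP[i /andP[i1 i2]]|/existsPn no].
    by exists i.
  exfalso.
  have eqw i : w i < nu i -> w i = w 0.
    move=> lt; case: (ltnP i m) => im; last by have := nu_zero im; lia.
    have := no (Ordinal im); rewrite /= lt /= -leqNgt => le.
    have w_le : w i <= w 0.
      by case: i {im le} lt => [//|i] lt; have := wnu i.+1; have := wnu 0; have := @nu_le 1 i.+1; lia.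
    lia.
  have [i0 d0 max0] : exists2 i, w i < nu i & forall j, w j < nu j -> j <= i.
    have bnd j : w j < nu j -> j <= m.
      by move=> lt; rewrite leqNgt; apply/negP => jm; have := nu_zero (ltnW jm); lia.
    by case: (@ex_maxnP (fun j => w j < nu j) m) => //; [exists r | move=> i; exists i].
  have x0 : 0 < w 0.
    rewrite lt0n; apply/eqP => z.
    have : ps w m.-1 = 0.
      rewrite (@ps_zero _ 0) // => i _ _.
      have := wnu i; have := wnu 0; case: i => [//|i].
      by have := @nu_le 1 i.+1; lia.
    have := S_bound (ltnW m2); rewrite wtot //; lia.
  have i0m : i0 < m by rewrite ltnNge; apply/negP => /nu_zero; lia.
  have flat j : i0 < j -> w j = nu j.
    by move=> ij; have := wnu j; case: (ltnP (w j) (nu j)) => [/max0|]; lia.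
  (* The last row [i0] met by the strip cannot lie after the pivot: [nu] would be constant, hence 0,
     from row [i0.+1] on, and [w i0 = 0 < w 0]. *)
  have ti0 : i0 <= t.
    rewrite leqNgt; apply/negP => ti.
    have cst j : i0 < j -> nu j = nu j.+1 by move=> ij; rewrite -(flat j ij) w2 // /f; lia.
    have z : nu i0.+1 = 0.
      have : forall d, nu i0.+1 = nu (i0.+1 + d).
        by elim=> [|d ->]; rewrite ?addn0 // addnS; apply: cst; lia.
      by move=> /(_ m) ->; apply: nu_zero; lia.
    by have := eqw _ d0; rewrite w2 // /f z; lia.
  (* If the strip lies in row 0, then [nu 0 = w 0 + a 0]. Either [nu] is a single row, or [w 0] is
     [B 1] or [nu 0 - 1]; the overlap excludes the first two cases through [nu 0 <= B 0], and
     [a 0 >= 2] the last. *)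
  case: (posnP i0) => [z0|p0].
    have b0 := B_step (i := 0) (leq_trans (isT : 0 < 2) m2).
    have n0B := nuB 0.
    have red : nu 0 = w 0 + a 0.
      have := ps_shift nu m.-1; have := ps_shift w m.-1.
      have -> : m.-1.+1 = m by lia.
      rewrite w5 nutot.
      have -> : ps (fun i => w i.+1) m.-1 = ps (fun i => nu i.+1) m.-1.
        by apply: ps_eq => i _; apply: flat; lia.
      lia.
    case: (posnP t) => [t0|tp].
      have cst j : 0 < j -> nu j = nu j.+1.
        by move=> ij; rewrite -(flat j) ?w2 // /f; lia.
      have z : nu 1 = 0.
        have : forall d, nu 1 = nu (1 + d).
          by elim=> [|d ->]; rewrite ?addn0 // addnS; apply: cst; lia.
        by move=> /(_ m) ->; apply: nu_zero; lia.
      have : ps nu m = ps nu 1.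
        apply: ps_zero => [|i i1 _]; first lia.
        by have := @nu_le 1 i; lia.
      rewrite /= nutot; have := BE 0; lia.
    have := w1 0 tp; rewrite /u; case: (0 == r); lia.
  have t0 : 0 < t by lia.
  (* Now row 0 is filled up to its cap [B 1] and row 1 has the same length, against
     [w 1 <= B 2 < B 1]. *)
  have n1 : w 0 < nu 1.
    by have := @nu_le 1 i0; have := eqw _ d0; lia.
  have w0B : w 0 = B 1.
    have := w1 0 t0; rewrite /u; have := numono 0.
    by case: (eqVneq 0 r) => [rz|_]; [have := r2; rewrite -rz; lia | lia].
  have w1E : w 1 = w 0.
    apply: eqw; have := wB 1; have := B_lt (i := 1); lia.
  have := wB 1; have := @B_lt 1; lia.
Qed.

End Step.

(** * Chains for given row lengths and overlaps *)

Definition tail_sum (l : nat) (al : nat -> nat) (i : nat) := \sum_(i <= q < l) al q.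
Definition overlaps (l : nat) (e : nat -> bool) (i : nat) := \sum_(i <= q < l.-1) (e q : nat).

(* [N r] is the shape formed by the horizontal strips of the ribbon rows
   [r, r.+1, ...]; the last field says that, where rows [r] and [r.+1] overlap,
   the topmost row met by the strip of [r.+1] lies above the lowest row met by
   the strip of [r]. *)
Record strip_chain (l : nat) (al : nat -> nat) (e : nat -> bool) (N : nat -> nat -> nat)
    (s : nat) : Prop := {
  chain_end : forall i, N l i = 0;
  chain_sub : forall r i, s <= r -> r < l -> N r.+1 i <= N r i;
  chain_hor : forall r i, s <= r -> r < l -> N r i.+1 <= N r.+1 i;
  chain_size : forall r, s <= r -> r < l -> ps (N r) l = ps (N r.+1) l + al r;
  chain_desc : forall r, s <= r -> r.+1 < l -> e r ->
    exists i i', [/\ i' < i, N r.+2 i' < N r.+1 i' & N r.+1 i < N r i] }.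

Section Chain.
Variables (l : nat) (al : nat -> nat) (e : nat -> bool).
Hypothesis al2 : forall i, i < l -> 2 <= al i.
Hypothesis al0 : forall i, l <= i -> al i = 0.
Hypothesis almono : forall i, al i.+1 <= al i.
Local Notation S := (tail_sum l al).
Local Notation o := (overlaps l e).
Local Notation B i := (S i - o i).

Lemma tail_sumS i : S i = al i + S i.+1.
Proof.
rewrite /tail_sum; case: (ltnP i l) => h; first by rewrite big_ltn.
by rewrite al0 // !big_geq //; lia.
Qed.

Lemma tail_sum0 i : l <= i -> S i = 0.
Proof. by move=> h; rewrite /tail_sum big_geq. Qed.

Lemma overlapsS i : i.+1 < l -> o i = e i + o i.+1.
Proof. by move=> h; rewrite /overlaps big_ltn //; lia. Qed.

Lemma overlaps0 i : l <= i.+1 -> o i = 0.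
Proof. by move=> h; rewrite /overlaps big_geq //; lia. Qed.

Lemma tail_sum_ps k : ps al k + S k = S 0.
Proof. by elim: k => [//|k IH] /=; have := tail_sumS k; lia. Qed.

(** The conditions of the theorem for the ribbon rows [>= s] alone; [ribbon_step] passes them on to
    the rows [> s], so they serve as induction invariant. *)
Definition admissible (s : nat) (nu : nat -> nat) : Prop :=
  [/\ forall i, nu i.+1 <= nu i, forall i, nu i <= B (s + i),
      ps nu (l - s) = S s & forall k, ps (fun i => al (s + i)) k <= ps nu k].

Lemma admissible_ps s nu k : admissible s nu -> l - s <= k -> ps nu k = S s.
Proof.
case=> _ b t _ h; rewrite (ps_zero h) // => i h1 _.
by have := b i; rewrite tail_sum0; lia.
Qed.

Lemma chain_exists s nu : s <= l -> admissible s nu ->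
  exists N, [/\ strip_chain l al e N s, forall i, N s i = nu i &
    s < l -> exists r, nu r = nu 0 /\ N s.+1 r < nu r].
Proof.
move=> sl; have [d] : exists d, l = s + d by exists (l - s); lia.
elim: d s nu {sl} => [|d IH] s nu ld adm.
  exists (fun _ _ => 0); split; last lia.
    by split=> // r; lia.
  by move=> i; case: adm => _ b _ _; have := b i; rewrite tail_sum0; lia.
have [m1 m2 m3 m4] := adm.
have ds : l - s = d.+1 by lia.
have nz : al s <= nu 0 by have := m4 1; rewrite /= addn0; lia.
have sl : s < l by lia.
have al2s := al2 sl.
have nuz i : l - s <= i -> nu i = 0 by move=> h; have := m2 i; rewrite tail_sum0; lia.
have [r [r1 r2]] : exists r, nu r = nu 0 /\ nu r.+1 < nu 0.
  case: (@ex_minnP (fun i => nu i < nu 0)); first by exists (l - s); rewrite nuz; lia.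
  case=> [|r] h min; first by rewrite ltnn in h.
  exists r; split=> //.
  have : nu r <= nu 0 by elim: (r) => [//|j hj]; have := m1 j; lia.
  by case: (ltnP (nu r) (nu 0)) => [/min|]; lia.
case: d => [|d] in IH ld ds *.
  exists (fun r i => if r <= s then nu i else 0); split.
  - split.
    + by move=> i; case: leqP => //; lia.
    + by move=> r' i h1 h2; case: (leqP r'.+1 s); lia.
    + move=> r' i h1 h2; case: (leqP r'.+1 s) => h3; first by lia.
      have -> : r' = s by lia.
      by rewrite leqnn nuz; lia.
    + move=> r' h1 h2; have -> : r' = s by lia.
      rewrite leqnn ltnn (@ps_zero (fun _ => 0) 0) // (admissible_ps adm); last lia.
      by rewrite tail_sumS tail_sum0 // /=; lia.
    + by move=> r'; lia.
  - by move=> i; rewrite leqnn.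
  - by move=> _; exists r; rewrite ltnn; lia.
have addS0 : s + 0 = s by lia.
have [w [w1 w2 w3 w4 [w5 w6]]] : exists w,
  [/\ forall i, nu i.+1 <= w i <= nu i,
      forall i, w i <= B (s + i.+1),
      ps w (l - s).-1 = S (s + 1),
      forall k, ps (fun i => al (s + i.+1)) k <= ps w k &
      w r < nu r /\ (e s -> exists i, w i < nu i /\ w i < w 0)].
  apply: (@ribbon_step (l - s) (fun i => al (s + i)) (fun i => S (s + i)) (fun i => o (s + i))
            (fun i => B (s + i)) nu (e s)) => //.
  - by lia.
  - by move=> i; rewrite addnS; exact: tail_sumS.
  - by move=> i h; apply: al2; lia.
  - by move=> i h; apply: tail_sum0; lia.
  - by move=> i; rewrite addnS.
  - move=> i; rewrite addnS; case: (ltnP (s + i).+1 l) => h.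
      by rewrite (overlapsS h) leq_addl.
    by rewrite !overlaps0 //; lia.
  - move=> i; rewrite addnS; case: (ltnP (s + i).+1 l) => h.
      by rewrite (overlapsS h); case: (e _).
    by rewrite !overlaps0 //; lia.
  - by move=> i h; apply: overlaps0; lia.
  - by rewrite addn1 addn0 overlapsS //; lia.
  - by rewrite addn0.
have wadm : admissible s.+1 w.
  split.
  - by move=> i; have := w1 i; have := w1 i.+1; lia.
  - by move=> i; rewrite addSnnS.
  - by rewrite subnS -addn1.
  - move=> k; rewrite (@ps_eq _ (fun i => al (s + i.+1))); first exact: w4.
    by move=> i _; rewrite addSnnS.
have [|N [cN Nw Ntop]] := IH s.+1 w _ wadm; first by lia.
pose N' r' i := if r' <= s then nu i else N r' i.
have N's i : N' s i = nu i by rewrite /N' leqnn.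
have N'w i : N' s.+1 i = w i by rewrite /N' ltnn Nw.
have N'N r' i : s < r' -> N' r' i = N r' i by move=> h; rewrite /N' leqNgt h.
exists N'; split => //; last by move=> _; exists r; rewrite N'w.
split.
- by move=> i; rewrite N'N //; exact: (chain_end cN).
- move=> r' i h1 h2; case: (eqVneq r' s) => [->|ne].
    by rewrite N's N'w; have := w1 i; lia.
  by rewrite !N'N; [apply: (chain_sub cN); lia | lia | lia].
- move=> r' i h1 h2; case: (eqVneq r' s) => [->|ne].
    by rewrite N's N'w; have := w1 i; lia.
  by rewrite !N'N; [apply: (chain_hor cN); lia | lia | lia].
- move=> r' h1 h2; case: (eqVneq r' s) => [->|ne].
    rewrite (ps_eq (g := nu)) => [|i _]; last exact: N's.
    rewrite [in RHS](ps_eq (g := w)) => [|i _]; last exact: N'w.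
    rewrite (admissible_ps adm) ?(admissible_ps wadm); [|lia..].
    by rewrite tail_sumS addnC.
  rewrite (ps_eq (g := N r')) => [|i _]; last by apply: N'N; lia.
  rewrite [in RHS](ps_eq (g := N r'.+1)) => [|i _]; last by apply: N'N; lia.
  by apply: (chain_size cN); lia.
- move=> r' h1 h2 er; case: (eqVneq r' s) => [rs|ne].
    have es : e s by rewrite -rs.
    have [i [i1 i2]] := w6 es.
    have [|r0 [r01 r02]] := Ntop; first by lia.
    (* Row [i] comes from the step and [r0] from the induction; [w i < w 0 = w r0] places [r0] above
       [i]. *)
    exists i, r0; rewrite rs; split.
    + rewrite ltnNge; apply/negP => h.
      have : w r0 <= w i.
        by elim: r0 h {r01 r02} => [|j hj] h; [have -> : i = 0 by lia | have := w1 j; have := w1 j.+1; case: (eqVneq i j.+1) => [->//|ne]; have := hj; lia].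
      lia.
    + by rewrite N'w N'N //; lia.
    + by rewrite N'w N's.
  have [i [i' [h3 h4 h5]]] := chain_desc cN (r := r') ltac:(lia) h2 er.
  by exists i, i'; rewrite !N'N //; lia.
Qed.

Section Necessary.
Variable N : nat -> nat -> nat.
Hypothesis cN : strip_chain l al e N 0.

Let hor r i : r < l -> N r i.+1 <= N r.+1 i. Proof. exact: (chain_hor cN). Qed.
Let sub r i : r < l -> N r.+1 i <= N r i. Proof. exact: (chain_sub cN). Qed.

(** Each horizontal strip moves the shape down by at most one row. At [i = 0] this bounds row [r] of
    the final shape by the first part of [N r]. *)
Lemma chain_diag r i : r <= l -> N 0 (r + i) <= N r i.
Proof.
elim: r i => [//|r IH] i rl; have := IH i.+1 (ltnW rl); have := hor i rl.
by rewrite addSnnS; lia.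
Qed.

Lemma chain_zero r i : r <= l -> l <= r + i -> N r i = 0.
Proof.
move=> rl; have [d] : exists d, l = r + d by exists (l - r); lia.
elim: d r i {rl} => [|d IH] r i ld h.
  have -> : r = l by lia.
  exact: (chain_end cN).
case: i h => [|i] h; first lia.
by have := @hor r i; have := IH r.+1 i; lia.
Qed.

Lemma chain_ps r k : r <= l -> l <= k + r -> ps (N r) k = S r.
Proof.
move=> rl lk.
have -> : ps (N r) k = ps (N r) l.
  rewrite (ps_zero (j := l - r)); [|lia|]; last by move=> i *; apply: chain_zero; lia.
  by apply/esym/ps_zero; [lia|] => i *; apply: chain_zero; lia.
have [d] : exists d, l = r + d by exists (l - r); lia.
elim: d r rl {lk} => [|d IH] r rl ld.
  have -> : r = l by lia.
  by rewrite tail_sum0 // (ps_zero (j := 0)) // => i *; exact: (chain_end cN).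
rewrite (chain_size cN) //; last lia.
by rewrite IH; [rewrite (tail_sumS r) addnC | lia | lia].
Qed.

Lemma chain_head r : r <= l -> N r 0 + o r <= S r.
Proof.
move=> rl; suff : o r <= ps (fun i => N r i.+1) l.
  have := ps_shift (N r) l; rewrite chain_ps //; lia.
have [d] : exists d, l = r + d by exists (l - r); lia.
elim: d r rl => [|d IH] r rl ld; first by rewrite overlaps0 //; lia.
case: (ltnP r.+1 l) => h; last by rewrite overlaps0.
rewrite overlapsS //; have := IH r.+1 (ltnW h) ltac:(lia).
case er : (e r); last first.
  move=> h2; apply: leq_trans h2 _; apply: ps_leq => i _; by apply: sub; lia.
have [i [i0 [h3 _ h5]]] := chain_desc cN (r := r) (leq0n r) h er.
(* As [i' < i], the strip of row [r] has a box outside of the first row. *)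
case: i h3 h5 => [//|i] h3 h5.
have il : i < l.
  by rewrite ltnNge; apply/negP => li; have := @chain_zero r i.+1; lia.
have : ps (fun j => N r.+1 j.+1 + (j == i) * 1) l <= ps (fun j => N r j.+1) l.
  apply: ps_leq => j _; case: (eqVneq j i) => [->|ne]; first lia.
  by have := @sub r j.+1; lia.
by rewrite psD ps_delta //; lia.
Qed.

Lemma chain_admissible : admissible 0 (N 0).
Proof.
split.
- move=> i; case: (posnP l) => [l0|lp].
    by have := @chain_zero 0 i.+1; lia.
  by have := @hor 0 i lp; have := @sub 0 i lp; lia.
- move=> i; rewrite add0n; case: (leqP i l) => il.
    by have := chain_diag 0 il; rewrite addn0; have := chain_head il; lia.
  by have := @chain_zero 0 i; lia.
- by rewrite chain_ps //; lia.
- move=> k; rewrite (ps_eq (g := al)) => [|i _]; last by rewrite add0n.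
  have := tail_sum_ps k; case: (leqP k l) => kl; last first.
    by rewrite (@chain_ps 0) //; lia.
  (* The rows of [N 0] from [k] on fit into [N k], which has [S k] boxes; the first [k] rows hold
     the rest. *)
  have h j : ps (N 0) (k + j) <= ps (N 0) k + ps (N k) j.
    elim: j => [|j IH]; first by rewrite addn0; lia.
    by rewrite addnS !psS; have := chain_diag j kl; lia.
  have := h l; rewrite (@chain_ps 0) ?(@chain_ps k) //; lia.
Qed.

End Necessary.
End Chain.

(** * Ribbons *)

Lemma lr_pattern la mu n nu : skew_shape la mu ->
  (exists T, T \in lr_set la mu n nu) <->
  (exists p, [/\ gt_pattern n (nth 0 mu) (nth 0 la) p,
     forall J v, v.+1 < n -> pat_cnt (size la) p J v <= pat_cnt (size la) p J v.+1 &
     forall v, v < n -> pat_wt (size la) p v = nth 0 nu (n - v.+1)]).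
Proof.
move=> Hs; split=> [[T]|[p [Hp gp wp]]].
  rewrite inE => /and3P[sT /(goodP Hs) gT /eqP/mnmP wT].
  have Hp := tab_pat_gt Hs sT; have cT := tab_patP Hs sT.
  exists (tab_pat T); split=> // [J v vn|v vn].
    by have := gT J v vn; rewrite !(tab_cntE Hs _ Hp cT) //; lia.
  by have := wT (Ordinal vn); rewrite !mnmE /= (tab_wtE Hs Hp cT).
have [T cT] := compat_ex Hs Hp; exists T; rewrite inE (compat_ssyt Hs Hp cT) /=.
apply/andP; split.
  by apply/(goodP Hs) => J v vn; rewrite !(tab_cntE Hs _ Hp cT) //; [exact: gp | lia].
by apply/eqP/mnmP => v; rewrite !mnmE (tab_wtE Hs Hp cT) // wp.
Qed.

Section Ribbon.
Variables (alpha la mu : seq nat).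
Hypothesis halpha : is_part alpha.
Hypothesis halpha2 : all (fun x => 2 <= x) alpha.
Hypothesis hR : ribbon_with_rows alpha la mu.

Local Notation l := (size alpha).
Local Notation al := (nth 0 alpha).
Local Notation L := (nth 0 la).
Local Notation M := (nth 0 mu).

(** The last column of row [r.+1] is the first column of row [r]. *)
Definition overlap_at r := L r.+1 == (M r).+1.
Local Notation e := overlap_at.

Lemma ribbon_skew : skew_shape la mu. Proof. by case: hR => [[]]. Qed.
Let Hs := ribbon_skew.
Let sla : size la = l. Proof. by case: hR. Qed.

Lemma al_ge2 i : i < l -> 2 <= al i. Proof. by move=> h; apply: (allP halpha2); exact: mem_nth. Qed.
Lemma al_out i : l <= i -> al i = 0. Proof. exact: nth_default. Qed.
Lemma al_noninc i : al i.+1 <= al i. Proof. exact: is_part_noninc. Qed.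
Lemma L_out i : l <= i -> L i = 0. Proof. by move=> h; rewrite nth_default // sla. Qed.
Lemma ML r : M r <= L r. Proof. by case: Hs. Qed.
Lemma M_out i : l <= i -> M i = 0. Proof. by move=> h; have := ML i; rewrite L_out //; lia. Qed.
Lemma LE r : L r = M r + al r. Proof. by case: hR => _ _ h _; have := h r; have := ML r; lia. Qed.
Lemma L_le i j : i <= j -> L j <= L i.
Proof. by apply: noninc_leq => k; apply: is_part_noninc; case: Hs. Qed.
Lemma M_le i j : i <= j -> M j <= M i.
Proof. by apply: noninc_leq => k; apply: is_part_noninc; case: Hs. Qed.

Lemma L_leM i j : i < j -> L j <= (M i).+1.
Proof.
move=> ij; apply: leq_trans (L_le ij) _; rewrite leqNgt; apply/negP => h.
case: hR => [[_ /(_ i (M i)) no2] _ _ _]; case/negP: no2.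
have il : i < l by rewrite ltnNge; apply/negP => li; rewrite L_out in h; lia.
rewrite /in_skew; have := al_ge2 il; have := LE i; have := @M_le i i.+1 (leqnSn i).
by move=> *; apply/and4P; split; lia.
Qed.

Lemma col_lengthS r c : r < l ->
  col_length_from la mu r c = in_skew la mu r c + col_length_from la mu r.+1 c.
Proof.
move=> rl; rewrite /col_length_from sla; have -> : l - r = (l - r.+1).+1 by lia.
by [].
Qed.

Lemma col_length_out r c : L r <= c -> col_length_from la mu r c = 0.
Proof.
move=> Lc; apply/eqP; rewrite /col_length_from -leqn0 leqNgt -has_count.
apply/hasPn => r'; rewrite mem_iota => /andP[rr' _].
by rewrite /in_skew; have := L_le rr'; lia.
Qed.

(** Adding row [r] on top creates at most one new column of length two, column [M r]. No column of
    length two is extended, because row [r.+1] has at least two boxes. *)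
Lemma overlapping_partitionE r : nth 0 (overlapping_partition la mu) r = overlaps l e r.
Proof.
case: (ltnP r l) => rl; last first.
  by rewrite nth_default ?size_mkseq ?sla // overlaps0 //; lia.
rewrite nth_mkseq ?sla //.
have [d ld] : exists d, l = r.+1 + d by exists (l - r.+1); lia.
elim: d r rl ld => [|d IH] r rl ld.
  rewrite overlaps0; last lia.
  apply/eqP; rewrite -leqn0 leqNgt -has_count; apply/hasPn => c _.
  rewrite col_lengthS // col_length_out; last by rewrite L_out; lia.
  by case: in_skew.
have rl1 : r.+1 < l by lia.
rewrite overlapsS // -(IH r.+1 rl1); last lia.
rewrite addnC.
have colE c : in_skew la mu r c -> col_length_from la mu r.+1 c = ((c == M r) && e r).
  case/andP => h1 h2; rewrite /e; have := L_leM (ltnSn r) => h3.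
  case: (leqP (L r.+1) c) => h4; first by rewrite col_length_out //; lia.
  have cM : c = M r by lia.
  rewrite cM eqxx /= col_lengthS // col_length_out /in_skew.
    by have := @M_le r r.+1; lia.
  have := L_leM (ltnSn r.+1); have := al_ge2 rl1; have := LE r.+1; lia.
rewrite (@count_add _ (fun c => col_length_from la mu r.+1 c == 2) (fun c => (c == M r) && e r)).
  congr (_ + _); case er : (e r); last by rewrite (eq_count (a2 := pred0)) ?count_pred0 // => c; rewrite andbF.
  rewrite (eq_count (a2 := pred1 (M r))) => [|c]; last by rewrite /= andbT.
  rewrite count_uniq_mem ?iota_uniq // mem_iota /=.
  have := la_head Hs r; have := LE r; have := al_ge2 rl; lia.
move=> c; rewrite col_lengthS //; case isk : (in_skew la mu r c).
  by rewrite colE //; case: (_ && _).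
have -> : (c == M r) = false.
  by apply/eqP => cM; move: isk; rewrite cM /in_skew; have := LE r; have := al_ge2 rl; lia.
by rewrite addn0.
Qed.

Lemma tele_ps (f : nat -> nat) n k : (forall i, i < n -> f i <= f i.+1) ->
  ps (fun i => f (n - i) - f (n - i.+1)) k = f n - f (n - k).
Proof.
move=> mono; elim: k => [|k IH] /=; first by rewrite subn0 subnn.
rewrite IH; have : f (n - k) <= f n.
  elim: k {IH} => [|k IH]; first by rewrite subn0.
  case: (ltnP k n) => h; last by have -> : n - k.+1 = n - k by lia.
  have := mono (n - k.+1); have -> : (n - k.+1).+1 = n - k by lia.
  by lia.
case: (ltnP k n) => h; last by have -> : n - k.+1 = n - k; lia.
have := mono (n - k.+1); have -> : (n - k.+1).+1 = n - k by lia.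
by lia.
Qed.

(** Part [i] of the shape belongs to the value [n - i.+1]: [m r i] counts it in row [r], and [N r i]
    in the rows [>= r]. *)
Lemma pattern_chain n nu p : gt_pattern n M L p -> size nu <= n ->
  (forall J v, v.+1 < n -> pat_cnt (size la) p J v <= pat_cnt (size la) p J v.+1) ->
  (forall v, v < n -> pat_wt (size la) p v = nth 0 nu (n - v.+1)) ->
  exists N, strip_chain l al e N 0 /\ forall i, N 0 i = nth 0 nu i.
Proof.
rewrite sla => Hp sn gp wp.
pose m r i := p (n - i) r - p (n - i.+1) r.
pose N r i := \sum_(r <= r' < l) m r' i.
have NS r i : r < l -> N r i = m r i + N r.+1 i by move=> rl; rewrite /N big_ltn.
have Nend r i : l <= r -> N r i = 0 by move=> h; rewrite /N big_geq.
have m0 r i : n <= i -> m r i = 0.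
  by move=> h; rewrite /m; have -> : n - i.+1 = n - i; lia.
have Lmono j : L j.+1 <= L j by apply: L_le.
have hor r i : r < l -> N r i.+1 <= N r.+1 i.
  move=> rl; have [d ld] : exists d, l = r + d by exists (l - r); lia.
  elim: d r rl ld => [|d IH] r rl ld; first lia.
  case: (ltnP i.+1 n) => iN; last first.
    by rewrite /N big1 // => r' _; exact: m0.
  pose v := n - i.+2.
  have v1 : n - i.+1 = v.+1 by rewrite /v; lia.
  have v2 : n - i = v.+2 by rewrite /v; lia.
  have vn : v.+1 < n by lia.
  case: (eqVneq (p v.+1 r) (M r)) => [pM|pM].
    have mz : m r i.+1 = 0.
      by rewrite /m v1 pM -/v; have := gt_leq Hp r (leq0n v) (ltnW (ltnW vn)); rewrite (gt_bot Hp); lia.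
    rewrite NS // mz add0n; case: (ltnP r.+1 l) => rl1; last by rewrite Nend.
    have := IH r.+1 rl1 ltac:(lia); have := NS _ i rl1; lia.
  have Jgt : M r < p v.+1 r.
    by have := gt_leq Hp r (leq0n v.+1) (ltnW vn); rewrite (gt_bot Hp); lia.
  (* Cut where the entries [<= v] of row [r] end: all [v] in the rows [>= r] lie to the left,
     whereas a [v.+1] to the left can only lie in the rows [> r]. The lattice condition at [J] is
     then the strip condition. *)
  set J := p v.+1 r.
  have full r' k : r < r' -> k <= n -> p k r' <= J.
    move=> rr kn; have := gt_leq Hp r' kn (leqnn n); rewrite (gt_top Hp).
    by have := L_leM rr; rewrite /J; lia.
  apply: leq_trans (_ : pat_cnt l p J v <= _).
    rewrite /N /pat_cnt -(big_mkord xpredT (fun r => minn J (p v.+1 r) - minn J (p v r))).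
    rewrite (@big_cat_nat _ _ _ r 0 l) //=; last lia.
    apply: leq_trans (leq_addl _ _).
    rewrite big_nat [X in _ <= X]big_nat; apply: leq_sum => r' /andP[rr' _].
    rewrite /m v1 -/v; have := gt_le Hp (k := v) r'.
    case: (eqVneq r' r) => [->|ne]; first by rewrite -/J; lia.
    by have := full r' v.+1; have := full r' v; lia.
  apply: leq_trans (gp J v vn) _.
  rewrite /N /pat_cnt -(big_mkord xpredT (fun r => minn J (p v.+2 r) - minn J (p v.+1 r))).
  rewrite (@big_cat_nat _ _ _ r.+1 0 l) //=.
  rewrite [X in X + _]big_nat [X in X + _]big1 ?add0n; last first.
    move=> r' /andP[_ rr'].
    have : J <= p v.+1 r'.
      rewrite /J; apply: (noninc_leq (f := p v.+1)); last lia.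
      by move=> k; apply: (gt_noninc Hp) => //; lia.
    lia.
  rewrite big_nat [X in _ <= X]big_nat; apply: leq_sum => r' /andP[rr' _].
  by rewrite /m v1 v2; have := full r' v.+1; have := full r' v.+2; lia.
have Nzero r i : r <= l -> l <= r + i -> N r i = 0.
  move=> rl; have [d] : exists d, l = r + d by exists (l - r); lia.
  elim: d r i {rl} => [|d IH] r i ld h; first by apply: Nend; lia.
  case: i h => [|i] h; first lia.
  by have := hor r i; have := IH r.+1 i; lia.
exists N; split; last first.
  move=> i; rewrite /N big_mkord; case: (ltnP i n) => iN; last first.
    by rewrite big1 => [|r _]; [rewrite nth_default //; lia | exact: m0].
  have := wp (n - i.+1); have -> : n - (n - i.+1).+1 = i by lia.
  move=> <-; last lia.
  by apply: eq_bigr => r _; rewrite /m; have -> : (n - i.+1).+1 = n - i by lia.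
split.
- by move=> i; apply: Nend.
- by move=> r i _ rl; rewrite (NS r) // leq_addl.
- by move=> r i _ rl; apply: hor.
- move=> r _ rl.
  rewrite (ps_eq (g := fun i => m r i + N r.+1 i)) => [|i _]; last exact: NS.
  rewrite psD addnC; congr (_ + _).
  have -> : ps (m r) l = ps (m r) (l + n).
    apply/esym/ps_zero; first lia.
    by move=> i li _; have := Nzero r i; have := NS r i; lia.
  rewrite (tele_ps (f := fun k => p k r)) => [|i iN]; last exact: (gt_le Hp).
  have -> : n - (l + n) = 0 by lia.
  by rewrite (gt_top Hp) (gt_bot Hp) LE; lia.
- move=> r _ rl1 er.
  have rl : r < l by lia.
  have eL : L r.+1 = (M r).+1 by apply/eqP.
  have al1 := al_ge2 rl1.
  (* In the common column, [y] is the last entry of row [r.+1] and [x] the first entry of row [r]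
     above it, so [x < y]; reversing values gives the descent. *)
  case: (@ex_minnP (fun k => L r.+1 <= p k r.+1)); first by exists n; rewrite (gt_top Hp).
  case=> [|y] hy miny; first by move: hy; rewrite (gt_bot Hp) LE; lia.
  have yn : y < n by apply: miny; rewrite (gt_top Hp).
  have pyr : M r < p y r by have := gt_il Hp r yn; lia.
  case: (@ex_minnP (fun k => M r < p k r)); first by exists y.
  case=> [|x] hx minx; first by move: hx; rewrite (gt_bot Hp); lia.
  have xy : x < y by apply: minx.
  have py : p y r.+1 < L r.+1 by rewrite ltnNge; apply/negP => /miny; lia.
  have px : p x r <= M r by rewrite leqNgt; apply/negP => /minx; lia.
  exists (n - x.+1), (n - y.+1); split; first lia.
    rewrite (NS r.+1) // -[X in X < _]add0n ltn_add2r /m.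
    have -> : n - (n - y.+1) = y.+1 by lia.
    have -> : n - (n - y.+1).+1 = y by lia.
    lia.
  rewrite (NS r) // -[X in X < _]add0n ltn_add2r /m.
  have -> : n - (n - x.+1) = x.+1 by lia.
  have -> : n - (n - x.+1).+1 = x by lia.
  lia.
Qed.

Lemma chain_pattern n nu N : strip_chain l al e N 0 -> (forall i, N 0 i = nth 0 nu i) ->
  size nu <= n ->
  exists p, [/\ gt_pattern n M L p,
     forall J v, v.+1 < n -> pat_cnt (size la) p J v <= pat_cnt (size la) p J v.+1 &
     forall v, v < n -> pat_wt (size la) p v = nth 0 nu (n - v.+1)].
Proof.
rewrite sla => cN N0 sn.
have sub r i : r < l -> N r.+1 i <= N r i by apply: (chain_sub cN).
have Nn r i : r <= l -> n <= i -> N r i = 0.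
  move=> rl ni; have : N r i <= N 0 i.
    by elim: r rl => [//|r IH] rl; have := IH (ltnW rl); have := sub r i rl; lia.
  by rewrite N0 nth_default; lia.
pose m r i := N r i - N r.+1 i.
have mps r : r < l -> ps (m r) n = al r.
  move=> rl.
  have e1 r' : r' <= l -> ps (N r') n = ps (N r') l.
    move=> rl'; transitivity (ps (N r') (n + l)).
      by apply/esym/ps_zero; [lia|] => i h _; apply: Nn.
    by apply: ps_zero; [lia|] => i h _; apply: (chain_zero cN) => //; lia.
  have : ps (N r) n = ps (fun i => m r i + N r.+1 i) n.
    by apply: ps_eq => i _; rewrite /m subnK //; exact: sub.
  rewrite psD !e1 //; last exact: ltnW.
  by rewrite (chain_size cN) //; lia.
pose p k r := if r < l then M r + (ps (m r) n - ps (m r) (n - k)) else 0.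
have pd v r : r < l -> v < n -> p v.+1 r = p v r + m r (n - v.+1).
  move=> rl vn; rewrite /p rl.
  have -> : n - v = (n - v.+1).+1 by lia.
  rewrite psS; have := @ps_mono (m r) (n - v.+1).+1 n ltac:(lia); rewrite psS.
  by lia.
have pout k r : l <= r -> p k r = 0 by rewrite /p; case: ltnP; lia.
have pge k r : r < l -> M r <= p k r by rewrite /p => ->; lia.
have ple k r : r < l -> p k r <= L r by move=> rl; rewrite /p rl LE mps //; lia.
have Hp : gt_pattern n M L p.
  split.
  - move=> r; rewrite /p; case: ltnP => rl; first by rewrite subn0 subnn addn0.
    by rewrite M_out.
  - move=> r; rewrite /p; case: ltnP => rl; last by rewrite L_out.
    by rewrite subnn /= subn0 mps // LE.
  - move=> k r kn; case: (ltnP r l) => rl; last by rewrite !pout.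
    by rewrite pd // leq_addr.
  - move=> k r kn; case: (ltnP r.+1 l) => rl1; last by rewrite (pout k.+1).
    have rl : r < l by lia.
    have h1 := ple k.+1 _ rl1; have h2 := L_leM (ltnSn r); have h3 := pge k _ rl.
    case: (leqP (p k.+1 r.+1) (M r)) => h4; first lia.
    (* Interlacing can fail only in the common column. There row [r.+1] is complete at level [k.+1],
       so [n - k.+1 <= i' < i], and the strip of row [r] supplies an entry [< k]. *)
    have er : e r by rewrite /e; lia.
    have [i [i' [ii mi' mi]]] := chain_desc cN (leq0n r) rl1 er.
    have iN : i < n by rewrite ltnNge; apply/negP => h; have := Nn r i; lia.
    have z : ps (m r.+1) (n - k.+1) = 0.
      have : p k.+1 r.+1 = L r.+1 by lia.
      rewrite /p rl1 LE mps //; have := @ps_mono (m r.+1) (n - k.+1) n ltac:(lia).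
      by rewrite mps //; have := al_ge2 rl1; lia.
    have ki : n - k.+1 <= i'.
      rewrite leqNgt; apply/negP => h; have := @ps_mono (m r.+1) i'.+1 (n - k.+1) h.
      by rewrite z psS /m; lia.
    suff : 0 < ps (m r) n - ps (m r) (n - k) by rewrite {2}/p rl; lia.
    have := @ps_mono (m r) i.+1 n iN; have := @ps_mono (m r) (n - k) i ltac:(lia).
    by rewrite psS /m; lia.
exists p; split=> //.
- move=> J v vn.
  (* Rows above [r0] have no box in the first [J] columns and rows below it lie entirely within
     them, so the strip condition at [r0] compares the two counts. *)
  have [r0 [r0l lo hi]] : exists r0, [/\ r0 <= l, forall r, r < r0 -> J <= M r &
      r0 < l -> M r0 < J].
    case: (boolP [exists r : 'I_l, M r < J]) => [/existsP[i0 hi0]|/existsPn no]; last first.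
      exists l; split=> // [r rl|]; last lia.
      by rewrite leqNgt; exact: (no (Ordinal rl)).
    case: (@ex_minnP (fun r => (r < l) && (M r < J))); first by exists i0; rewrite ltn_ord.
    move=> r0 /andP[h1 h2] min; exists r0; split=> // [|r rr]; first exact: ltnW.
    by rewrite leqNgt; apply/negP => h; have := min r; rewrite h andbT; lia.
  pose i := n - v.+2.
  have i1 : n - v.+1 = i.+1 by rewrite /i; lia.
  have tele r j : r <= l -> \sum_(r <= r' < l) m r' j = N r j.
    move=> rl; have [d] : exists d, l = r + d by exists (l - r); lia.
    elim: d r {rl} => [|d IH] r ld.
      by rewrite big_geq; [have -> : r = l by lia | lia]; rewrite (chain_end cN).
    rewrite big_ltn ?IH; [|lia..].
    by rewrite /m subnK //; apply: sub; lia.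
  case: (ltnP r0 l) => rl; last first.
    rewrite /pat_cnt big1 // => r _; have rl' := ltn_ord r.
    by have := lo r; have := pge v r rl'; have := pge v.+1 r rl'; lia.
  apply: leq_trans (_ : N r0 i.+1 <= _).
    rewrite -(tele r0) // /pat_cnt -(big_mkord xpredT (fun r => minn J (p v.+1 r) - minn J (p v r))).
    rewrite (@big_cat_nat _ _ _ r0 0 l) //=.
    rewrite [X in X + _]big_nat [X in X + _]big1 ?add0n; last first.
      move=> r' /andP[_ rr']; have rl' : r' < l by lia.
      by have := lo r' rr'; have := pge v r' rl'; have := pge v.+1 r' rl'; lia.
    rewrite big_nat [X in _ <= X]big_nat; apply: leq_sum => r' /andP[_ rr'].
    by rewrite (pd v) ?i1; lia.
  apply: leq_trans (chain_hor cN i (leq0n r0) rl) _.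
  rewrite -(tele r0.+1) // /pat_cnt -(big_mkord xpredT (fun r => minn J (p v.+2 r) - minn J (p v.+1 r))).
  rewrite (@big_cat_nat _ _ _ r0.+1 0 l) //=.
  apply: leq_trans (leq_addl _ _).
  rewrite big_nat [X in _ <= X]big_nat; apply: leq_sum => r' /andP[rr rl'].
  have := L_leM rr; have := hi rl; have := ple v.+2 r' rl'; have := ple v.+1 r' rl'.
  by rewrite (pd v.+1) -?/i; lia.
- move=> v vn; rewrite -N0 /pat_wt.
  rewrite (eq_bigr (fun r : 'I_l => m r (n - v.+1))) => [|r _]; last by rewrite pd //; lia.
  rewrite -(big_mkord xpredT (fun r => m r (n - v.+1))).
  have: forall r, r <= l -> \sum_(0 <= r' < r) m r' (n - v.+1) + N r (n - v.+1) = N 0 (n - v.+1).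
    elim=> [|r IH] rl; first by rewrite big_geq.
    by rewrite big_nat_recr //= -(IH (ltnW rl)) /m -addnA subnK //; exact: sub.
  by move/(_ l (leqnn l)); rewrite (chain_end cN) addn0.
Qed.

Theorem ribbon_support nu : schur_support la mu nu <->
  is_part nu /\ admissible l al e 0 (nth 0 nu).
Proof.
split.
  case/(support_lr Hs) => pn /(lr_pattern _ _ Hs) [p [Hp gp wp]]; split=> //.
  have [N [cN N0]] := pattern_chain Hp (leqnn _) gp wp.
  have [h1 h2 h3 h4] := chain_admissible al_out cN.
  split.
  - by move=> i; rewrite -!N0.
  - by move=> i; rewrite -N0.
  - by rewrite -h3; apply: ps_eq => i _; rewrite N0.
  - by move=> k; apply: leq_trans (h4 k) _; apply: ps_leq => i _; rewrite N0.
case=> pn adm; apply: (lr_support Hs pn); apply/(lr_pattern _ _ Hs).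
have [N [cN N0 _]] := chain_exists al_ge2 al_out al_noninc (leq0n l) adm.
exact: chain_pattern cN N0 (leqnn _).
Qed.

End Ribbon.

(** * The dominance interval and the witness *)

Lemma sumn_take_ps s k : sumn (take k s) = ps (nth 0 s) k.
Proof.
elim: k => [|k IH] /=; first by rewrite take0.
rewrite -IH; case: (ltnP k (size s)) => h.
  by rewrite (take_nth 0 h) sumn_rcons.
by rewrite !take_oversize ?nth_default ?addn0 //; lia.
Qed.

Lemma sumn_ps s k : size s <= k -> sumn s = ps (nth 0 s) k.
Proof. by move=> h; rewrite -sumn_take_ps take_oversize. Qed.

(** The truncated expression is the maximum of [a i] and [b]. As [a] decreases, it follows [a] first
    and is then constantly [b]; dominance controls the first stretch and [b <= nu i] the second. *)
Lemma ps_max_dom (a nu : nat -> nat) b k :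
  (forall i, a i.+1 <= a i) -> (forall i, ps a i <= ps nu i) ->
  (forall i, i < k -> b <= nu i) -> ps (fun i => a i + (b - a i)) k <= ps nu k.
Proof.
move=> am dom; elim: k => [//|k IH] hb.
case: (leqP b (a k)) => h.
  apply: leq_trans (dom k.+1); apply: ps_leq => i ik.
  by have := noninc_leq (f := a) am (i := i) (j := k); lia.
by have := IH (fun i lt => hb i (ltnW lt)); have := hb k (ltnSn k); rewrite !psS; lia.
Qed.

Section Bounds.
Variables (l : nat) (al : nat -> nat) (e : nat -> bool).
Hypothesis al2 : forall i, i < l -> 2 <= al i.
Hypothesis al0 : forall i, l <= i -> al i = 0.

Lemma overlaps_bound i : i < l -> overlaps l e i + i.+1 <= l.
Proof.
move=> il; rewrite /overlaps.
have : \sum_(i <= q < l.-1) (e q : nat) <= \sum_(i <= q < l.-1) 1.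
  by apply: leq_sum => q _; case: (e q).
by rewrite sum_nat_const_nat; lia.
Qed.

Lemma tail_sum_bound i : i <= l -> 2 * (l - i) <= tail_sum l al i.
Proof.
move=> il; apply: leq_trans (_ : \sum_(i <= q < l) 2 <= _).
  by rewrite sum_nat_const_nat mulnC.
by rewrite big_nat /tail_sum [X in _ <= X]big_nat; apply: leq_sum => q /andP[_ /al2].
Qed.

Lemma overlaps_shift i : overlaps l e 0 <= overlaps l e i + i.
Proof.
elim: i => [|i IH]; first by rewrite addn0.
case: (ltnP i.+1 l) => h; last by rewrite (@overlaps0 l e i) in IH; lia.
by rewrite (overlapsS e h) in IH; case: (e i) IH; lia.
Qed.

Lemma overlaps_noninc i : overlaps l e i.+1 <= overlaps l e i.
Proof.
case: (ltnP i.+1 l) => h; first by rewrite (overlapsS e h) leq_addl.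
by rewrite !overlaps0 //; lia.
Qed.

End Bounds.

Theorem theorem1p6 (alpha la mu p : seq nat)
    (halpha : is_part alpha) (halpha2 : all (fun x => 2 <= x) alpha)
    (hR : ribbon_with_rows alpha la mu) (hp : p = overlapping_partition la mu) :
  (proper_subset (schur_support la mu)
     (dom_interval alpha [:: sumn alpha - part p 1; part p 1])
   <->
   2 <= nb_nonzero p /\
   exists i, [/\ 1 <= i, i <= nb_nonzero p - 1 &
     \sum_(1 <= j < i.+1) (rho alpha p i - part alpha j) <= part p i.+1 - 1])
  /\
  (forall i, 1 <= i -> i <= nb_nonzero p - 1 ->
     \sum_(1 <= j < i.+1) (rho alpha p i - part alpha j) <= part p i.+1 - 1 ->
     [/\ forall j, 1 <= j -> j <= i ->
           rho alpha p i <= part alpha j + gtilde alpha p i j,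
         part p i.+1 - 1 - gtilde_size alpha p i <= rho alpha p i,
         is_part (decr_rearrangement (witness_seq alpha p i)) /\
         sumn (decr_rearrangement (witness_seq alpha p i)) = sumn alpha,
         dom_interval alpha [:: sumn alpha - part p 1; part p 1]
           (decr_rearrangement (witness_seq alpha p i)) &
         ~ schur_support la mu (decr_rearrangement (witness_seq alpha p i))]).
Proof.
set l := size alpha; pose al := nth 0 alpha; pose e := overlap_at la mu.
pose S := tail_sum l al; pose o := overlaps l e.
have al2 i : i < l -> 2 <= al i := @al_ge2 alpha halpha2 i.
have al0 i : l <= i -> al i = 0 := @al_out alpha i.
have alm i : al i.+1 <= al i  by apply: al_noninc.
have Sps k : ps al k + S k = S 0 := tail_sum_ps al0 k.
have SS i : S i = al i + S i.+1 := tail_sumS al0 i.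
have S0 i : l <= i -> S i = 0  by apply: tail_sum0.
have Sb i : i <= l -> 2 * (l - i) <= S i  by apply: tail_sum_bound.
have ob i : i < l -> o i + i.+1 <= l  by apply: overlaps_bound.
have oz i : l <= i.+1 -> o i = 0  by apply: overlaps0.
have osh i : o 0 <= o i + i  by apply: overlaps_shift.
have pE i : nth 0 p i = o i by rewrite hp (overlapping_partitionE halpha halpha2 hR).
have partp i : part p i.+1 = o i by rewrite /part pE.
have psorted : sorted geq p.
  by apply: sorted_geq_nth => i; rewrite !pE; exact: overlaps_noninc.
have nbE i : (i < nb_nonzero p) = (0 < o i) by rewrite nb_nonzero_lt // pE.
have sumal : sumn alpha = S 0 by rewrite (sumn_ps (leqnn _)) -/al -(Sps l) S0 ?addn0.
have oS i : o i <= S i.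
  by case: (ltnP i l) => h; [have := ob i h; have := Sb i (ltnW h); lia | rewrite oz; lia].
have rhoE i : rho alpha p i = (S i - o i).+1.
  rewrite /rho partp big_add1 /= -/l.
  have -> : \sum_(i <= q < l) part alpha q.+1 = S i by [].
  by have := oS i; lia.
have gE i : \sum_(1 <= j < i.+1) (rho alpha p i - part alpha j) =
            ps (fun j => rho alpha p i - al j) i.
  rewrite big_add1 /= /part /=; move: (rho alpha p i) => b.
  elim: i => [|k IH]; first by rewrite big_geq.
  by rewrite big_nat_recr //= IH.
(* The upper end has two parts, so being dominated by it only bounds the first part. *)
have intE nu : dom_interval alpha [:: sumn alpha - part p 1; part p 1] nu <->
    [/\ is_part nu, sumn nu = S 0, forall k, ps al k <= ps (nth 0 nu) k & nth 0 nu 0 <= S 0 - o 0].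
  rewrite /dom_interval /dominated /= partp sumal addn0 subnK; last exact: oS.
  split.
    case=> pn [h1 h2] [_ h3]; split=> // [k|].
      by have := h2 k; rewrite !sumn_take_ps.
    by have := h3 1; rewrite sumn_take_ps /= addn0.
  case=> pn h1 h2 h3; split=> //; split=> // k; first by rewrite !sumn_take_ps.
  case: k => [|[|k]] /=; first by rewrite take0.
    by rewrite sumn_take_ps /= addn0.
  by rewrite addn0 subnK ?oS // -h1 -{2}(cat_take_drop k.+2 nu) sumn_cat leq_addr.
have supE nu := ribbon_support halpha halpha2 hR nu.
have sup_int nu : schur_support la mu nu ->
    dom_interval alpha [:: sumn alpha - part p 1; part p 1] nu.
  case/supE => pn [m1 m2 m3 m4]; apply/intE; split=> //.
  rewrite -/l subn0 in m3; rewrite (sumn_ps (leq_maxl (size nu) l)).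
  rewrite (ps_zero (leq_maxr (size nu) l)) // => i li _.
  by have := m2 i; rewrite add0n tail_sum0 // sub0n leqn0 => /eqP.
have wit i : 1 <= i -> i <= nb_nonzero p - 1 ->
    \sum_(1 <= j < i.+1) (rho alpha p i - part alpha j) <= part p i.+1 - 1 ->
     [/\ forall j, 1 <= j -> j <= i ->
           rho alpha p i <= part alpha j + gtilde alpha p i j,
         part p i.+1 - 1 - gtilde_size alpha p i <= rho alpha p i,
         is_part (decr_rearrangement (witness_seq alpha p i)) /\
         sumn (decr_rearrangement (witness_seq alpha p i)) = sumn alpha,
         dom_interval alpha [:: sumn alpha - part p 1; part p 1]
           (decr_rearrangement (witness_seq alpha p i)) &
         ~ schur_support la mu (decr_rearrangement (witness_seq alpha p i))].
  move=> i1 inb; rewrite gE partp => gle.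
  have oi : 0 < o i by rewrite -nbE; lia.
  have il : i.+1 < l by rewrite ltnNge; apply/negP => h; rewrite oz in oi; lia.
  have obi := ob i (ltnW il); have Sbi := Sb i (ltnW (ltnW il)); have Sbi1 := Sb i.+1 (ltnW il).
  have SSi := SS i; have rE := rhoE i.
  set g := ps _ i in gle; set b := rho alpha p i in rE *.
  have gs : gtilde_size alpha p i = g by exact: gE.
  set W := witness_seq alpha p i.
  have W1 k : k < i -> nth 0 W k = al k + (b - al k).
    move=> ki; rewrite nth_cat size_map size_iota ki (nth_map 0) ?size_iota //.
    by rewrite nth_iota // /gtilde /part.
  have W2 : nth 0 W i = b by rewrite nth_cat size_map size_iota ltnn subnn.
  have W3 : nth 0 W i.+1 = o i - 1 - g.
    by rewrite nth_cat size_map size_iota ltnNge leqnSn /= subSnn /= gs partp.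
  have sW : size W = i.+2 by rewrite size_cat size_map size_iota /= addn2.
  have W4 k : i.+2 <= k -> nth 0 W k = 0 by move=> h; rewrite nth_default // sW.
  have Wm k : nth 0 W k.+1 <= nth 0 W k.
    case: (ltnP k.+1 i) => h; first by rewrite !W1 //; [have := alm k; lia | lia].
    case: (eqVneq k.+1 i) => [ki|n1]; first by rewrite ki W2 W1; lia.
    case: (eqVneq k i) => [->|n2]; first by rewrite W2 W3; lia.
    by rewrite (W4 k.+1); lia.
  have Ws : sorted geq W by exact: sorted_geq_nth.
  (* The witness is already decreasing; only its last entry can be zero and be dropped. *)
  have DE : decr_rearrangement W = [seq x <- W | x != 0].
    by rewrite /decr_rearrangement sorted_sort //; exact: geq_trans.
  have Wi : ps (nth 0 W) i = ps al i + g.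
    by rewrite -psD; apply: ps_eq => k ki; rewrite W1.
  have Wk k : i.+2 <= k -> ps (nth 0 W) k = S 0.
    move=> ik; rewrite (ps_zero ik) => [|j h _]; last exact: W4.
    by rewrite !psS W2 W3 Wi; have := Sps i; lia.
  have Dsum : sumn (decr_rearrangement W) = S 0.
    by rewrite DE sumn_filter_nz (@sumn_ps _ i.+2) ?sW // Wk.
  have Dpart : is_part (decr_rearrangement W) by rewrite DE; exact: is_part_filter.
  have Dnth k : nth 0 (decr_rearrangement W) k = nth 0 W k by rewrite DE nth_filter_nz.
  split.
  - by move=> j _ _; rewrite /gtilde -/b; lia.
  - by rewrite gs rE; lia.
  - by rewrite sumal.
  - apply/intE; split=> // [k|].
      have -> : ps (nth 0 (decr_rearrangement W)) k = ps (nth 0 W) k by apply: ps_eq.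
      case: (leqP k i) => ki.
        by apply: ps_leq => j jk; rewrite W1; lia.
      case: (eqVneq k i.+1) => [->|n1]; first by rewrite !psS Wi W2; lia.
      by rewrite Wk; [have := Sps k; lia | lia].
    rewrite Dnth W1 //.
    (* The first [i] rows add at least [2 * i] boxes and at most [i] overlaps; as [i >= 1], this
       covers the 1 in [b = B i + 1]. *)
    have b0 : b <= S 0 - o 0.
      have : 2 * i <= ps al i.
        have := @ps_ge al 2 0 i (leq0n i); rewrite subn0 /= add0n; apply => j _ ji.
        by apply: al2; lia.
      by have := Sps i; have := osh i; lia.
    have := SS 0; have := ob 0 ltac:(lia); have := Sb 1 ltac:(lia); lia.
  - by case/supE => _ [_ /(_ i) + _ _]; rewrite Dnth W2 add0n -/l -/al -/S -/e -/o; lia.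
split=> //; split.
  case=> _ [nu [/intE [pn tot dom n0] nsup]].
  have totk k : size nu <= k -> ps (nth 0 nu) k = S 0 by move=> h; rewrite -sumn_ps.
  have lek k : ps (nth 0 nu) k <= S 0.
    by rewrite -(totk (maxn k (size nu))) ?leq_maxr // ps_mono // leq_maxl.
  have totl : ps (nth 0 nu) l = S 0.
    by have := lek l; have := dom l; have := Sps l; rewrite (S0 l) //; lia.
  have nm i : nth 0 nu i.+1 <= nth 0 nu i by exact: is_part_noninc.
  case: (boolP [forall i : 'I_l, nth 0 nu i <= S i - o i]) => [/forallP hall|/forallPn [[i il]] /=].
    case: nsup; apply/supE; split=> //; split=> //.
    + move=> i; rewrite add0n; case: (ltnP i l) => il; first exact: (hall (Ordinal il)).
      have := lek i.+1; rewrite psS.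
      by have := ps_mono (nth 0 nu) il; rewrite totl; lia.
    + by rewrite -/l subn0.
  rewrite -ltnNge => lt.
  have ip : 0 < i by case: i il lt => [|//] il lt; lia.
  have bn j : j < i -> rho alpha p i <= nth 0 nu j.
    by move=> ji; have := noninc_leq (f := nth 0 nu) nm (i := j) (j := i); rewrite rhoE; lia.
  (* The first [i] rows hold at least [ps al i] plus the gaps, and row [i] at least [rho]; within
     the total [S 0] the gaps are left with at most [o i - 1]. *)
  have := ps_max_dom alm dom bn; rewrite psD => h1.
  have h2 := lek i.+1; rewrite psS in h2.
  have h3 := Sps i; have h4 := rhoE i.
  have h5 : ps (fun j => rho alpha p i - al j) i < o i by have := oS i; lia.
  have inb : i < nb_nonzero p by rewrite nbE; lia.
  split; first lia.
  by exists i; rewrite gE partp; split=> //; lia.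
case=> _ [i [i1 inb h]]; have [_ _ _ di ns] := wit i i1 inb h.
by split=> //; exists (decr_rearrangement (witness_seq alpha p i)).
Qed.
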